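(* Let $(E,<)$ be a finite totally ordered set and $r\ge 1$. For every hyperline sequence $X$ of rank $r$ over $E$ (i.e. with $E(X)=E$), the set of positively oriented bases of $X$ is the set of positively oriented bases of some chirotope of rank $r$ over $E$. Conversely, for every chirotope $\chi$ of rank $r$ over $E$, the set of positively oriented bases of $\chi$ is the set of positively oriented bases of some hyperline sequence of rank $r$ over $E$.
   Context: Signed indices: let $\overline E=\{\overline e\mid e\in E\}$ be a disjoint copy of $E$ and $\mathbf E=E\sqcup\overline E$; extend $e\mapsto\overline e$ to an involution by $\overline{\overline e}=e$. Put $e^*=\overline e^*=e$, and for $X\subset\mathbf E$ put $\overline X=\{\overline x\mid x\in X\}$, $X^*=\{x^*\mid x\in X\}$. Oriented simplices: an oriented $d$-simplex in $E$ is a tuple $[x_1,\dots,x_{d+1}]$ of elements of $\mathbf E$ with $x_1^*,\dots,x_{d+1}^*$ pairwise distinct; $\Delta_d(E)$ is the set of these. The equivalence $\sim$ on oriented $d$-simplices is generated by $[x_1,\dots,x_{d+1}]\sim[x_1,\dots,x_{i-1},\overline{x_{i+1}},x_i,x_{i+2},\dots,x_{d+1}]$ ($i=1,\dots,d$). Put $-[x_1,\dots,x_{d+1}]=[x_1,\dots,x_d,\overline{x_{d+1}}]$. Chirotope of rank $r$ over $E$: a map $\chi:\Delta_{r-1}(E)\to\{-1,0,+1\}$ (with the convention that $\chi$ of a tuple that is not an oriented simplex is $0$) such that (C1) for each $e_1\in E$ there are $e_2,\dots,e_r\in E$ with $\chi([e_1,\dots,e_r])\ne0$; (C2) $\chi(-\sigma)=-\chi(\sigma)$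 for all $\sigma$, and $\sigma\sim\tau$ implies $\chi(\sigma)=\chi(\tau)$; (C3) if $\chi([x_1,\dots,x_r])\neq0$ and $\chi([y_1,\dots,y_r])\ne0$, then $\chi([x_1,\dots,x_{r-1},y_i])\neq 0$ for some $i$; (C4) if $x_1,\dots,x_r,y_1,y_2\in\mathbf E$ satisfy $\chi([x_1,\dots,x_{r-2},y_1,x_r])\cdot\chi([x_1,\dots,x_{r-1},y_2])\ge0$ and $\chi([x_1,\dots,x_{r-2},y_2,x_r])\cdot\chi([x_1,\dots,x_{r-1},\overline{y_1}])\ge0$, then $\chi([x_1,\dots,x_r])\cdot\chi([x_1,\dots,x_{r-2},y_1,y_2])\ge0$. A positively oriented base of $\chi$ is a $\sigma$ with $\chi(\sigma)=+1$. Hyperline sequences (defined recursively; $C_m=\mathbb Z/m$). Rank 1: a hyperline sequence over $E(X)\subset E$ is a nonempty $X\subset E(X)\cup\overline{E(X)}$ with $|X|=|X^*|$ and $X^*=E(X)$; its positively oriented bases are $[x]$, $x\in X$; $-X:=\overline X$. Rank 2: for some $k\ge2$, a map $a\mapsto X^a$ from $C_{2k}$ to rank-1 hyperline sequences (the atoms) with $X^{a+k}=-X^a$ for all $a$ and $E(X)\cup\overline{E(X)}$ the disjoint union of $X^0,\dots,X^{2k-1}$. $e$ is incident to $X^a$ if $e\in(X^a)^*$. $[x_1,x_2]$ is a positively oriented base if $x_1^*,x_2^*$ are not incident to a single atom and the atoms containing $x_1,x_2,\overline{x_1},\overline{x_2}$ occur in this cyclic order. $(-X)^a:=X^{-a}$.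 Two rank-2 sequences are equal if they have the same $E(X)$, same period $2k$ and differ by a shift of $C_{2k}$. Rank $r>2$: a nonempty set $X$ of pairs $(Y|Z)$ (hyperlines), $Y$ a hyperline sequence of rank $r-2$ and $Z$ of rank $2$. A positively oriented base of $X$ is an oriented simplex $[x_1,\dots,x_r]$ such that for some $(Y|Z)\in X$, $[x_1,\dots,x_{r-2}]$ is a positively oriented base of $Y$ and $[x_{r-1},x_r]$ one of $Z$. Put $-X=\{(Y|-Z)\mid (Y|Z)\in X\}$. $X$ is a hyperline sequence of rank $r$ over $E(X)$ if: (H1) $E(X)$ is the disjoint union of $E(Y)$ and $E(Z)$ for every $(Y|Z)\in X$; (H2) if $(Y_1|Z_1),(Y_2|Z_2)\in X$, $[x_1,\dots,x_{r-2}]$ is a positively oriented base of $Y_1$ and $\{x_1^*,\dots,x_{r-2}^*\}\subset E(Y_2)$, then $(Y_1|Z_1)=(Y_2|Z_2)$ or $(Y_1|Z_1)=(-Y_2|-Z_2)$; (H3) for all positively oriented bases $[x_1,\dots,x_r]$, $[y_1,\dots,y_r]$ of $X$ there is $j$ with $[x_1,\dots,x_{r-1},y_j]$ or $[x_1,\dots,x_{r-1},\overline{y_j}]$ a positively oriented base of $X$; (H4) if $[x_1,\dots,x_r]$ is a positively oriented base of $X$ then so is $[x_1,\dots,x_{r-3},\overline{x_{r-1}},x_{r-2},x_r]$.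
   Formalization: In the converse direction E is assumed nonempty: over the empty set the zero map satisfies (C1)–(C4) vacuously, but there is no hyperline sequence over the empty set, so the converse fails there. *)

(* Defs.v *)
From HB Require Import structures.
From mathcomp Require Import all_boot all_order all_algebra.

Set Implicit Arguments.
Unset Strict Implicit.
Unset Printing Implicit Defensive.

Import Order.TTheory GRing.Theory Num.Theory.
Local Open Scope ring_scope.

(* [inl e] is the element e itself and [inr e] is its barred copy. *)
Definition signed (E : finType) : finType := (E + E)%type.

Definition bar {E : finType} (x : signed E) : signed E :=
  match x with inl e => inr e | inr e => inl e end.

Definition star {E : finType} (x : signed E) : E :=
  match x with inl e => e | inr e => e end.

Definition barset {E : finType} (X : {set signed E}) : {set signed E} :=
  [set bar x | x in X].

Definition starset {E : finType} (X : {set signed E}) : {set E} :=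
  [set star x | x in X].

(* F together with its barred copy, as a set of signed indices. *)
Definition both_signs {E : finType} (F : {set E}) : {set signed E} :=
  [set x | star x \in F].

(* Tuples are lists; [oriented r s] says that s is an oriented (r-1)-simplex. *)
Definition oriented {E : finType} (r : nat) (s : seq (signed E)) : bool :=
  (size s == r) && uniq (map star s).

(* The step [x_1 .. x_{d+1}] ~ [x_1 .. bar x_{i+1}, x_i .. x_{d+1}] permutes
   the underlying indices, so it stays within the oriented simplices. *)
Inductive simplex_equiv {E : finType} :
    seq (signed E) -> seq (signed E) -> Prop :=
| SimplexSwap s x y t :
    simplex_equiv (s ++ [:: x, y & t]) (s ++ [:: bar y, x & t])
| SimplexRefl s : simplex_equiv s s
| SimplexSym s t : simplex_equiv s t -> simplex_equiv t s
| SimplexTrans s t u :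
    simplex_equiv s t -> simplex_equiv t u -> simplex_equiv s u.

Definition simplex_opp {E : finType} (s : seq (signed E)) : seq (signed E) :=
  match s with
  | [::] => [::]
  | x :: s' => rcons (belast x s') (bar (last x s'))
  end.

(* A map on oriented (r-1)-simplices is given by its extension by 0 to all
   lists.  In rank 1 the last axiom is vacuous. *)
Record chirotope {E : finType} (r : nat) (chi : seq (signed E) -> int) :
    Prop := Chirotope {
  chi_range : forall s, chi s \in [:: -1; 0; 1];
  chi_nonsimplex : forall s, ~~ oriented r s -> chi s = 0;
  chi_C1 : forall e1 : E, exists es : seq E,
    size (e1 :: es) = r /\ chi (map inl (e1 :: es)) != 0;
  chi_C2_opp : forall s, oriented r s -> chi (simplex_opp s) = - chi s;
  chi_C2_equiv : forall s t, oriented r s -> oriented r t ->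
    simplex_equiv s t -> chi s = chi t;
  chi_C3 : forall s x t, chi (rcons s x) != 0 -> chi t != 0 ->
    exists2 y, y \in t & chi (rcons s y) != 0;
  chi_C4 : forall p x x' y1 y2, (size p).+2 = r ->
    0 <= chi (p ++ [:: y1; x']) * chi (p ++ [:: x; y2]) ->
    0 <= chi (p ++ [:: y2; x']) * chi (p ++ [:: x; bar y1]) ->
    0 <= chi (p ++ [:: x; x']) * chi (p ++ [:: y1; y2])
}.

Definition chi_posbase {E : finType} (chi : seq (signed E) -> int)
  (s : seq (signed E)) : Prop := chi s = 1.

Definition hseq1_posbase {E : finType} (X : {set signed E})
  (s : seq (signed E)) : Prop := exists2 x, x \in X & s = [:: x].

(* Over the empty set there is no such X, whereas the zero map is a chirotope
   of every positive rank over it. *)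
Definition is_hseq1 {E : finType} (F : {set E}) (X : {set signed E}) : Prop :=
  [/\ X != set0, #|X| = #|starset X| & starset X = F].

(* A map from Z/2k to sets of signed indices, k being [half_period].  The type
   'Z_(k.*2) is Z/2k as soon as k > 0, which [is_hseq2] ensures. *)
Record hseq2 (E : finType) := Hseq2 {
  half_period : nat;
  atom : {ffun 'Z_(half_period.*2) -> {set signed E}}
}.

Definition is_hseq2 {E : finType} (F : {set E}) (Z : hseq2 E) : Prop :=
  [/\ (2 <= half_period Z)%N,
      forall a, is_hseq1 (starset (atom Z a)) (atom Z a),
      forall a, atom Z (a + (half_period Z)%:R) = barset (atom Z a),
      \bigcup_a atom Z a = both_signs F
    & forall a b, a != b -> [disjoint atom Z a & atom Z b]].

Definition hseq2_opp {E : finType} (Z : hseq2 E) : hseq2 E :=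
  Hseq2 [ffun a => atom Z (- a)].

Definition hseq2_shift {E : finType} (Z : hseq2 E)
    (c : 'Z_((half_period Z).*2)) : hseq2 E :=
  Hseq2 [ffun a => atom Z (a + c)].
Arguments hseq2_shift {E} Z c.

Definition hseq2_eq {E : finType} (Z Z' : hseq2 E) : Prop :=
  exists c, Z' = hseq2_shift Z c.

(* Starting from a and going round once, one meets b, then c, then d; the
   differences are compared as natural numbers less than n. *)
Definition cyclic_order4 (n : nat) (a b c d : 'Z_n) : bool :=
  (0 < val (b - a)%R < val (c - a)%R)%N
  && (val (c - a)%R < val (d - a)%R)%N.

Definition incident {E : finType} (Z : hseq2 E) (e : E)
  (a : 'Z_((half_period Z).*2)) : bool := e \in starset (atom Z a).
Arguments incident {E} Z e a.

Definition hseq2_posbase {E : finType} (Z : hseq2 E)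
    (s : seq (signed E)) : Prop :=
  exists x1 x2, [/\ s = [:: x1; x2],
    ~ (exists a, incident Z (star x1) a /\ incident Z (star x2) a)
  & exists a b c d,
      [/\ x1 \in atom Z a, x2 \in atom Z b,
          bar x1 \in atom Z c, bar x2 \in atom Z d & cyclic_order4 a b c d]].

(* What a rank contributes to the recursion: the type of candidate hyperline
   sequences of that rank, their equality, X |-> -X, their positively oriented
   bases, and the relation "X is a hyperline sequence with E(X) = F". *)
Record rank_data (E : finType) := RankData {
  rd_type : Type;
  rd_eq : rd_type -> rd_type -> Prop;
  rd_opp : rd_type -> rd_type;
  rd_posbase : rd_type -> seq (signed E) -> Prop;
  rd_is_hseq : {set E} -> rd_type -> Prop
}.

Definition rank0 (E : finType) : rank_data E :=
  @RankData E Empty_set (fun _ _ => True) id (fun _ _ => False)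
    (fun _ _ => False).

Definition rank1 (E : finType) : rank_data E :=
  @RankData E {set signed E} eq barset hseq1_posbase is_hseq1.

Definition rank2 (E : finType) : rank_data E :=
  @RankData E (hseq2 E) hseq2_eq hseq2_opp hseq2_posbase is_hseq2.

Section HigherRank.

(* D describes rank n; a set X of hyperlines, [X Y Z] meaning that the pair
   (Y|Z) belongs to X, is a candidate of rank n.+2. *)
Context {E : finType} (n : nat) (D : rank_data E).

Definition hyperlines : Type := rd_type D -> hseq2 E -> Prop.

(* Equality of sets of pairs, with respect to the equalities in rank n and in
   rank 2 (where sequences differing by a shift are equal). *)
Definition hyperlines_eq (X X' : hyperlines) : Prop :=
  (forall Y Z, X Y Z ->
     exists Y' Z', [/\ X' Y' Z', rd_eq Y Y' & hseq2_eq Z Z']) /\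
  (forall Y' Z', X' Y' Z' ->
     exists Y Z, [/\ X Y Z, rd_eq Y Y' & hseq2_eq Z Z']).

Definition hyperlines_opp (X : hyperlines) : hyperlines :=
  fun Y Z => exists2 Z0, X Y Z0 & Z = hseq2_opp Z0.

Definition hyperlines_posbase (X : hyperlines) (s : seq (signed E)) : Prop :=
  oriented n.+2 s /\
  exists Y Z,
    [/\ X Y Z, rd_posbase Y (take n s) & hseq2_posbase Z (drop n s)].

(* In H2, E(Y2) is the set FY2 such that Y2 is a hyperline sequence over FY2;
   it is unique by [is_hseq_ground_uniq]. *)
Record is_hyperlines (F : {set E}) (X : hyperlines) : Prop := IsHyperlines {
  hyperlines_nonempty : exists Y Z, X Y Z;
  hyperlines_H1 : forall Y Z, X Y Z -> exists FY FZ,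
    [/\ rd_is_hseq FY Y, is_hseq2 FZ Z, F = FY :|: FZ & [disjoint FY & FZ]];
  hyperlines_H2 : forall Y1 Z1 Y2 Z2 FY2 s,
    X Y1 Z1 -> X Y2 Z2 -> rd_posbase Y1 s ->
    rd_is_hseq FY2 Y2 -> {subset map star s <= FY2} ->
    (rd_eq Y1 Y2 /\ hseq2_eq Z1 Z2) \/
    (rd_eq Y1 (rd_opp Y2) /\ hseq2_eq Z1 (hseq2_opp Z2));
  hyperlines_H3 : forall s x t,
    hyperlines_posbase X (rcons s x) -> hyperlines_posbase X t ->
    exists2 y, y \in t & hyperlines_posbase X (rcons s y) \/
                         hyperlines_posbase X (rcons s (bar y));
  hyperlines_H4 : forall p x y z,
    hyperlines_posbase X (p ++ [:: x; y; z]) ->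
    hyperlines_posbase X (p ++ [:: bar y; x; z])
}.

Definition rank_up : rank_data E :=
  RankData hyperlines_eq hyperlines_opp hyperlines_posbase is_hyperlines.

End HigherRank.

(* Rank 0 is a dummy without any hyperline sequence. *)
Fixpoint rank_datum (E : finType) (r : nat) : rank_data E :=
  match r with
  | 0 => rank0 E
  | 1 => rank1 E
  | 2 => rank2 E
  | (_.+1 as n).+2 => rank_up n (rank_datum E n)
  end.

Definition hseq (E : finType) (r : nat) : Type := rd_type (rank_datum E r).

Definition hseq_posbase {E : finType} {r : nat} (X : hseq E r)
  (s : seq (signed E)) : Prop := rd_posbase X s.

Definition is_hseq {E : finType} {r : nat} (F : {set E}) (X : hseq E r) :
  Prop := rd_is_hseq F X.

Lemma both_signs_inj (E : finType) : injective (@both_signs E).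
Proof.
move=> F F' /setP eqF; apply/setP => e.
by have := eqF (inl e); rewrite !inE.
Qed.

Lemma is_hseq_ground_uniq (E : finType) (r : nat) (F F' : {set E})
  (X : hseq E r) : is_hseq F X -> is_hseq F' X -> F = F'.
Proof.
elim/ltn_ind: r F F' X => -[//|[|[|q]]] IH F F' X.
- by case=> _ _ <- [_ _ <-].
- by case=> _ _ _ eF _ [_ _ _ eF' _]; apply: both_signs_inj; rewrite -eF -eF'.
case=> -[Y [Z XYZ]] H1 _ _ _ [_ H1' _ _ _].
have [A [B [hA hB -> _]]] := H1 _ _ XYZ.
have [A' [B' [hA' hB' -> _]]] := H1' _ _ XYZ.
have -> : A = A' by apply: (IH q.+1) hA hA'.
by have -> : B = B' by apply: (IH 2%N _ _ _ Z).
Qed.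

(* Main.v *)
Require Import Defs.
From HB Require Import structures.
From mathcomp Require Import all_boot all_order all_algebra.
From mathcomp Require Import zify boolp.

Set Implicit Arguments.
Unset Strict Implicit.
Unset Printing Implicit Defensive.

Import Order.TTheory GRing.Theory Num.Theory.
Local Open Scope ring_scope.

(* In both directions one argues by induction on the rank, over arbitrary
   subsets F of the ground set, going from rank n to rank n + 2.

   A hyperline sequence X of rank n + 2 gives a sign map: +1 on its positively
   oriented bases, -1 on their opposites.  By H2 the line (Y|Z) whose Y has
   [x_1 .. x_n] as a positively oriented base is unique up to sign, so fixing
   x_1 .. x_n turns C4 for X into C4 for Z, which is a statement on four points
   of a circle.

   Conversely, let chi be a chirotope of rank n + 2.  A flat L of rank n with
   base b gives two minors, the restriction s |-> chi (s ++ [z1; z2]) to L and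
   the contraction t |-> chi (b ++ t) of rank 2 on F \ L, hence by induction a
   pair (Y|Z).  Two bases of L yield the same contraction up to one global sign:
   when a single element is exchanged, a term of the three-term relation
   vanishes, and any two bases of L are joined by exchanges.  So chi (s ++ t) is
   the product of the two signs, and the pairs (Y|Z), (-Y|-Z) over all flats L
   form the hyperline sequence.  In rank 2 the atoms are the classes of
   codirectional elements, sorted within a half-plane. *)

(** * Alternating maps on simplices *)

Section SignedIndices.

Context {E : finType}.
Implicit Types (x y : signed E) (p q s t : seq (signed E)).

Lemma barK : involutive (@bar E).
Proof. by case. Qed.

Lemma star_bar x : star (bar x) = star x.
Proof. by case: x. Qed.

Lemma star_eqP x y : star x = star y -> x = y \/ x = bar y.
Proof. by case: x; case: y => a b /= ->; [left|right|right|left]. Qed.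

Lemma mem_barset x (A : {set signed E}) : (x \in barset A) = (bar x \in A).
Proof.
apply/imsetP/idP => [[y yA ->]|bxA]; first by rewrite barK.
by exists (bar x); rewrite ?barK.
Qed.

Lemma mem_starset_star x (A : {set signed E}) :
  (star x \in starset A) = (x \in A) || (bar x \in A).
Proof.
apply/imsetP/orP => [[y yA /star_eqP[]->]|[]].
- by left.
- by right; rewrite barK.
- by exists x.
- by exists (bar x); rewrite ?star_bar.
Qed.

Lemma starset_barset (A : {set signed E}) : starset (barset A) = starset A.
Proof.
apply/setP => e; rewrite -[e]/(star (inl e)) !mem_starset_star !mem_barset barK.
by rewrite orbC.
Qed.

Lemma simplex_opp_rcons s x : simplex_opp (rcons s x) = rcons s (bar x).
Proof. by case: s => //= y s; rewrite belast_rcons last_rcons. Qed.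

Lemma simplex_oppK : involutive (@simplex_opp E).
Proof. by case/lastP => // s x; rewrite !simplex_opp_rcons barK. Qed.

Lemma simplex_opp_cat s x t :
  simplex_opp (s ++ x :: t) = s ++ simplex_opp (x :: t).
Proof. by rewrite lastI -rcons_cat !simplex_opp_rcons rcons_cat. Qed.

Lemma map_star_opp s : map star (simplex_opp s) = map star s.
Proof.
by case/lastP: s => // s x; rewrite simplex_opp_rcons !map_rcons star_bar.
Qed.

Lemma oriented_perm_star r s t :
  perm_eq (map star s) (map star t) -> oriented r s = oriented r t.
Proof.
move=> pst; rewrite /oriented (perm_uniq pst).
by rewrite -(size_map star s) (perm_size pst) size_map.
Qed.

Lemma perm_star_rot p x y q :
  perm_eq (map star (p ++ [:: bar y, x & q])) (map star (p ++ [:: x, y & q])).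
Proof.
rewrite !map_cat perm_cat2l /= star_bar.
by rewrite (perm_catCA [:: star y] [:: star x]).
Qed.

End SignedIndices.

Section AlternatingMaps.

Context {E : finType}.
Implicit Types (x y : signed E) (p q s t : seq (signed E)).
Implicit Types chi : seq (signed E) -> int.

Record alternating chi : Prop := Alternating {
  alt_bar : forall p x q, chi (p ++ bar x :: q) = - chi (p ++ x :: q);
  alt_swap : forall p x y q,
    chi (p ++ [:: y, x & q]) = - chi (p ++ [:: x, y & q])
}.

Lemma alternating_of_rot chi :
  (forall p x y q, chi (p ++ [:: bar y, x & q]) = chi (p ++ [:: x, y & q])) ->
  (forall s, chi (simplex_opp s) = - chi s) -> alternating chi.
Proof.
move=> rot opp.
have barN p x q : chi (p ++ bar x :: q) = - chi (p ++ x :: q).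
  elim: q p x => [|y q IH] p x; first by rewrite !cats1 -simplex_opp_rcons opp.
  by rewrite -[LHS]rot -[LHS]rot barK -cat_rcons IH cat_rcons.
by split=> // p x y q; rewrite -(rot p x) barN opprK.
Qed.

(* Quantifying over the continuation w makes the sign uniform in w. *)
Definition sign_eq chi s t : Prop :=
  (forall w, chi (s ++ w) = chi (t ++ w)) \/
  (forall w, chi (s ++ w) = - chi (t ++ w)).

Lemma sign_eq_refl chi s : sign_eq chi s s.
Proof. by left. Qed.

Lemma sign_eq_sym chi s t : sign_eq chi s t -> sign_eq chi t s.
Proof. by case=> st; [left|right] => w; rewrite st ?opprK. Qed.

Lemma sign_eq_trans chi t s u :
  sign_eq chi s t -> sign_eq chi t u -> sign_eq chi s u.
Proof.
by case=> st [] tu; [left|right|right|left] => w; rewrite st tu ?opprK.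
Qed.

Lemma sign_eq_neq0 chi s t w :
  sign_eq chi s t -> (chi (s ++ w) != 0) = (chi (t ++ w) != 0).
Proof. by case=> ->; rewrite ?oppr_eq0. Qed.

Section Alternating.

Context {chi : seq (signed E) -> int} (A : alternating chi).

Lemma sign_eq_map_star p s t :
  map star s = map star t -> sign_eq chi (p ++ s) (p ++ t).
Proof.
elim: s p t => [|x s IH] p [|y t] //= => [_|[exy est]].
  exact: sign_eq_refl.
apply: (@sign_eq_trans _ (p ++ y :: s)); last by rewrite -!cat_rcons; exact: IH.
case/star_eqP: exy => ->; first exact: sign_eq_refl.
by right=> w; rewrite -!catA; exact: (alt_bar A).
Qed.

Lemma sign_eq_move p x s t :
  sign_eq chi (p ++ x :: s ++ t) (p ++ s ++ x :: t).
Proof.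
elim: s p => [|y s IH] p; first exact: sign_eq_refl.
apply: (@sign_eq_trans _ (p ++ y :: x :: s ++ t)).
  by right=> w; rewrite -!catA; exact: (alt_swap A).
by have := IH (rcons p y); rewrite !cat_rcons.
Qed.

Lemma sign_eq_catCA p q s t :
  sign_eq chi (p ++ q ++ s ++ t) (p ++ s ++ q ++ t).
Proof.
elim: q p => [|x q IH] p; first exact: sign_eq_refl.
apply: (@sign_eq_trans _ (p ++ x :: s ++ q ++ t)); last exact: sign_eq_move.
by have := IH (rcons p x); rewrite !cat_rcons.
Qed.

Lemma sign_eq_perm_star s t :
  perm_eq (map star s) (map star t) -> sign_eq chi s t.
Proof.
have unsigned u : sign_eq chi u (map inl (map star u)).
  by apply: (sign_eq_map_star [::]); rewrite -[RHS]map_comp map_id_in.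
move=> /(perm_map (inl : E -> signed E)) pst.
apply: sign_eq_trans (unsigned s) _.
apply: sign_eq_trans (sign_eq_sym (unsigned t)).
apply: (catCA_perm_ind _ pst (sign_eq_refl _ _)) => p q u hs.
exact: sign_eq_trans hs (sign_eq_catCA [::] _ _ _).
Qed.

Lemma alt_neq0_perm_star s t :
  perm_eq (map star s) (map star t) -> chi s != 0 -> chi t != 0.
Proof.
by move=> /sign_eq_perm_star /(@sign_eq_neq0 _ _ _ [::]); rewrite !cats0 => ->.
Qed.

Lemma alt_neq0_perm s t : perm_eq s t -> chi s != 0 -> chi t != 0.
Proof. by move=> /(perm_map star); exact: alt_neq0_perm_star. Qed.

Lemma alt_double p x q : chi (p ++ [:: x, x & q]) = 0.
Proof. by apply/eqP; rewrite -eqNr -(alt_swap A). Qed.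

Lemma alt_uniq s : chi s != 0 -> uniq (map star s).
Proof.
rewrite -[in chi s](cat0s s); elim: s [::] => //= x s IH p nz.
apply/andP; split; last by apply: (IH (rcons p x)); rewrite cat_rcons.
apply/negP => /mapP[y ys exy]; case/splitPr: ys nz => s1 s2 nz.
suff: chi (p ++ s1 ++ [:: x, x & s2]) != 0 by rewrite catA alt_double eqxx.
apply: alt_neq0_perm_star nz; rewrite !(map_cat, map_cons) /= -exy perm_cat2l.
by rewrite (perm_catCA [:: star x]).
Qed.

Lemma alt_opp_cat s t :
  s != [::] -> chi (simplex_opp s ++ t) = - chi (s ++ t).
Proof.
by case/lastP: s => // s x _; rewrite simplex_opp_rcons !cat_rcons (alt_bar A).
Qed.

Lemma alt_move2 x y s t : chi (s ++ [:: x, y & t]) = chi ([:: x, y & s] ++ t).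
Proof.
elim/last_ind: s t => // s z IH t.
rewrite -!rcons_cons !cat_rcons -IH (alt_swap A).
by rewrite -[in LHS]cat_rcons (alt_swap A) opprK cat_rcons.
Qed.

Lemma alt_neq0_disjoint s t e :
  chi (s ++ t) != 0 -> e \in map star s -> e \notin map star t.
Proof.
move=> /alt_uniq; rewrite map_cat cat_uniq => /and3P[_ /hasPn nst _] es.
by apply/negP => /nst; rewrite /= es.
Qed.

End Alternating.

End AlternatingMaps.

(** * Chirotopes over a subset of the ground set *)

Section Chirotopes.

Context {E : finType}.
Implicit Types (x y : signed E) (p q s t b : seq (signed E)).
Implicit Types (F : {set E}) (chi : seq (signed E) -> int).

Definition satisfies_C4 (r : nat) chi : Prop :=
  forall p x x' y1 y2, (size p).+2 = r ->
    0 <= chi (p ++ [:: y1; x']) * chi (p ++ [:: x; y2]) ->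
    0 <= chi (p ++ [:: y2; x']) * chi (p ++ [:: x; bar y1]) ->
    0 <= chi (p ++ [:: x; x']) * chi (p ++ [:: y1; y2]).

(* C1 is dropped, so that minors are again prechirotopes. *)
Record prechirotope (r : nat) chi : Prop := Prechirotope {
  pc_alt :> alternating chi;
  pc_range : forall s, chi s \in [:: -1; 0; 1];
  pc_size : forall s, chi s != 0 -> size s = r;
  pc_C3 : forall s x t, chi (rcons s x) != 0 -> chi t != 0 ->
    exists2 y, y \in t & chi (rcons s y) != 0;
  pc_C4 : satisfies_C4 r chi
}.

Record chirotope_on F (r : nat) chi : Prop := ChirotopeOn {
  cho_pre :> prechirotope r chi;
  cho_ground : forall e,
    e \in F <-> exists2 s, chi s != 0 & e \in map star s
}.

Section Prechirotope.

Context {r : nat} {chi : seq (signed E) -> int} (H : prechirotope r chi).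

Lemma pc_cases s : [\/ chi s = -1, chi s = 0 | chi s = 1].
Proof.
have := pc_range H s; rewrite !inE.
by case/or3P => /eqP; [constructor 1|constructor 2|constructor 3].
Qed.

Lemma pc_neq0P s : chi s != 0 -> chi s = 1 \/ chi s = -1.
Proof. by have [] := pc_cases s => ->; [right| |left]. Qed.

Lemma pc_opp s : (0 < r)%N -> chi (simplex_opp s) = - chi s.
Proof.
move=> r0; have [->|s0] := eqVneq s [::]; last first.
  by rewrite -[simplex_opp s]cats0 (alt_opp_cat H) ?cats0.
suff -> : chi [::] = 0 by rewrite oppr0.
by apply/eqP; apply: contraTT r0 => /(pc_size H) <-.
Qed.

Lemma extend_to_base s t b : chi (s ++ t) != 0 -> chi b != 0 ->
  exists2 t', chi (s ++ t') != 0 & {subset t' <= b}.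
Proof.
move=> + hb; elim: t s => [|x t IH] s st; first by exists [::].
have {}st : chi (rcons (s ++ t) x) != 0.
  apply: (alt_neq0_perm H) st.
  by rewrite -cats1 -catA perm_cat2l -cat1s perm_catC.
have [y yb sty] := pc_C3 H st hb.
have [|t' yt' sub] := IH (rcons s y).
  apply: (alt_neq0_perm H) sty.
  by rewrite cat_rcons -cats1 -catA perm_cat2l perm_catC.
exists (y :: t'); first by rewrite -cat_rcons.
by move=> z; rewrite inE => /orP[/eqP->|/sub].
Qed.

End Prechirotope.

Section Prechirotope2.

Context {chi : seq (signed E) -> int} (H : prechirotope 2 chi).
Local Notation c x y := (chi [:: x; y]).

Lemma pc2_swap x y : c y x = - c x y.
Proof. exact: (alt_swap H [::]). Qed.

Lemma pc2_barl x y : c (bar x) y = - c x y.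
Proof. exact: (alt_bar H [::]). Qed.

Lemma pc2_barr x y : c x (bar y) = - c x y.
Proof. exact: (alt_bar H [:: x]). Qed.

Lemma pc2_diag x : c x x = 0.
Proof. exact: (alt_double H [::]). Qed.

Lemma pc2_C4 x x' y1 y2 : 0 <= c y1 x' * c x y2 ->
  0 <= c y2 x' * c x (bar y1) -> 0 <= c x x' * c y1 y2.
Proof. by have C4 := pc_C4 H; exact: (C4 [::] x x' y1 y2). Qed.

End Prechirotope2.

Lemma cho_sub_ground F r chi s :
  chirotope_on F r chi -> chi s != 0 -> {subset map star s <= F}.
Proof. by move=> H nz e es; apply/(cho_ground H); exists s. Qed.

Lemma cho_ground_cons F r chi x :
  chirotope_on F r chi -> star x \in F -> exists s, chi (x :: s) != 0.
Proof.
move=> H /(cho_ground H)[s nz /mapP[y ys exy]]; exists (rem y s).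
apply: (alt_neq0_perm_star H) nz; rewrite /= exy.
exact: (perm_map star (perm_to_rem ys)).
Qed.

Lemma chirotope_onT r chi :
  (0 < r)%N -> chirotope r chi -> chirotope_on [set: E] r chi.
Proof.
move=> r0 [range nonsimplex C1 opp equiv C3 C4].
have simplex s : chi s != 0 -> oriented r s.
  by apply: contraNT => /nonsimplex ->.
split; last first.
  move=> e; split=> // _; have [es [_ nz]] := C1 e.
  by exists (map inl (e :: es)); rewrite // inE eqxx.
split=> //; last by move=> s /simplex/andP[/eqP].
apply: alternating_of_rot => [p x y q|s].
  have [o|no] := boolP (oriented r (p ++ [:: x, y & q])).
    apply/esym/equiv => //; last exact: SimplexSwap.
    by rewrite (oriented_perm_star _ (perm_star_rot _ _ _ _)).
  by rewrite !nonsimplex // (oriented_perm_star _ (perm_star_rot _ _ _ _)).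
have [|no] := boolP (oriented r s); first exact: opp.
by rewrite !nonsimplex ?oppr0 // (oriented_perm_star _ (t := s)) ?map_star_opp.
Qed.

Lemma chirotope_of_onT r chi :
  (0 < r)%N -> chirotope_on [set: E] r chi -> chirotope r chi.
Proof.
move=> r0 H; split.
- exact: pc_range H.
- move=> s no; apply/eqP; apply: contraNT no => nz.
  by rewrite /oriented (pc_size H nz) eqxx (alt_uniq H nz).
- move=> e; have [s nz] := cho_ground_cons (x := inl e) H (in_setT _).
  exists (map star s); split; first by rewrite /= size_map -(pc_size H nz).
  apply: (alt_neq0_perm_star H) nz.
  by rewrite -[X in perm_eq _ X]map_comp map_id_in.
- by move=> s _; exact: (pc_opp H).
- move=> s t _ _; elim=> [p x y q|||s1 s2 s3 _ -> _ ->] //.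
  by rewrite (alt_bar H) -(alt_swap H).
- exact: pc_C3 H.
- exact: pc_C4 H.
Qed.

End Chirotopes.

Section Minors.

Context {E : finType}.
Implicit Types (x y : signed E) (p q s t b : seq (signed E)).
Implicit Types (L : {set E}) (chi : seq (signed E) -> int).

Definition contraction chi b t : int := chi (b ++ t).

Definition restriction L chi s : int :=
  if all [in L] (map star s) then chi s else 0.

Lemma alternating_contraction b chi :
  alternating chi -> alternating (contraction chi b).
Proof.
move=> A; split=> [p x q|p x y q]; rewrite /contraction !catA.
  exact: alt_bar A _ _ _.
exact: alt_swap A _ _ _ _.
Qed.

Lemma prechirotope_contraction r b chi :
  prechirotope (size b + r) chi -> prechirotope r (contraction chi b).
Proof.
move=> H; split.
- exact: alternating_contraction H.
- by move=> s; exact: pc_range H _.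
- by move=> s /(pc_size H)/eqP; rewrite size_cat eqn_add2l => /eqP.
- move=> s x t; rewrite /contraction -!rcons_cat => sx bt.
  have [y + bsy] := pc_C3 H sx bt; rewrite rcons_cat in bsy.
  rewrite mem_cat => /orP[yb|yt]; last by exists y.
  have := alt_neq0_disjoint H bsy (map_f star yb).
  by rewrite map_rcons mem_rcons inE eqxx.
- move=> p x x' y1 y2 sp; rewrite /contraction !catA; apply: (pc_C4 H).
  by rewrite size_cat -sp !addnS.
Qed.

Lemma restriction_neq0 L chi s : restriction L chi s != 0 ->
  {subset map star s <= L} /\ chi s != 0.
Proof. by rewrite /restriction; case: allP => //; rewrite eqxx. Qed.

Lemma restrictionE L chi s :
  {subset map star s <= L} -> restriction L chi s = chi s.
Proof. by rewrite /restriction => /allP->. Qed.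

Lemma alternating_restriction L chi :
  alternating chi -> alternating (restriction L chi).
Proof.
move=> A; split=> [p x q|p x y q]; rewrite /restriction.
  by rewrite !map_cat /= star_bar; case: ifP; rewrite ?oppr0 // (alt_bar A).
have -> : all [in L] (map star (p ++ [:: y, x & q])) =
          all [in L] (map star (p ++ [:: x, y & q])).
  by rewrite !map_cat !all_cat /= (andbCA (star y \in L)).
by case: ifP; rewrite ?oppr0 // (alt_swap A).
Qed.

Lemma prechirotope_restriction L r chi :
  prechirotope r chi -> prechirotope r (restriction L chi).
Proof.
move=> H; split.
- exact: alternating_restriction H.
- by move=> s; rewrite /restriction; case: ifP => // _; exact: pc_range H s.
- by move=> s /restriction_neq0[_ /(pc_size H)].
- move=> s x t /restriction_neq0[sxL sx] /restriction_neq0[tL ht].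
  have [y yt sy] := pc_C3 H sx ht; exists y => //.
  rewrite restrictionE // => e; rewrite map_rcons mem_rcons inE.
  case/orP => [/eqP->|es]; first by apply: tL; exact: map_f.
  by apply: sxL; rewrite map_rcons mem_rcons inE es orbT.
- move=> p x x' y1 y2 sp.
  have [->|] := eqVneq (restriction L chi (p ++ [:: x; x'])) 0.
    by rewrite mul0r.
  have [->|] := eqVneq (restriction L chi (p ++ [:: y1; y2])) 0.
    by rewrite mulr0.
  move=> /restriction_neq0[/allP yL _] /restriction_neq0[/allP xL _].
  move: xL yL; rewrite /restriction !map_cat !all_cat /= star_bar !andbT.
  move=> /and3P[-> -> ->] /and3P[_ -> ->]; exact: (pc_C4 H).
Qed.

End Minors.

(** * Oriented bases *)

Section OrientedBases.

Context {E : finType}.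
Implicit Types (x y : signed E) (p q s t : seq (signed E)) (F : {set E}).
Implicit Types P : seq (signed E) -> Prop.

(* C4 is left out: in higher rank it follows from the case of rank 2 by H2. *)
Record oriented_bases F (r : nat) P : Prop := OrientedBases {
  ob_size : forall s, P s -> size s = r;
  ob_ground : forall e, e \in F <-> exists2 s, P s & e \in map star s;
  ob_rot : forall p x y q,
    P (p ++ [:: x, y & q]) -> P (p ++ [:: bar y, x & q]);
  ob_opp : forall s, P s -> ~ P (simplex_opp s);
  ob_C3 : forall s x t, P (rcons s x) -> P t ->
    exists2 y, y \in t & P (rcons s y) \/ P (rcons s (bar y))
}.

Definition chi_of P s : int :=
  if `[< P s >] then 1 else if `[< P (simplex_opp s) >] then -1 else 0.

Definition realizes P (chi : seq (signed E) -> int) : Prop :=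
  forall s, P s <-> chi s = 1.

Lemma realizes_chi_of P : realizes P (chi_of P).
Proof.
move=> s; rewrite /chi_of; case: asboolP => [//|notPs].
by split=> [/notPs //|]; case: asboolP.
Qed.

Lemma chi_of_neq0 P s : chi_of P s != 0 <-> P s \/ P (simplex_opp s).
Proof.
rewrite /chi_of; case: asboolP => [Ps|notPs]; first by split=> // _; left.
case: asboolP => [Pos|notPos]; first by split=> // _; right.
by split=> // -[/notPs|/notPos].
Qed.

Lemma chi_of_opp P s : (P s -> ~ P (simplex_opp s)) ->
  chi_of P (simplex_opp s) = - chi_of P s.
Proof.
rewrite /chi_of simplex_oppK => excl.
by case: asboolP => Ps; case: asboolP => // /excl.
Qed.

Lemma eq_chi_of P Q s t : (P s <-> Q t) ->
  (P (simplex_opp s) <-> Q (simplex_opp t)) -> chi_of P s = chi_of Q t.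
Proof.
by rewrite /chi_of => /asbool_equiv_eq-> /asbool_equiv_eq->.
Qed.

Section OrientedBasesTheory.

Context {F : {set E}} {r : nat} {P : seq (signed E) -> Prop}.
Context (B : oriented_bases F r P).

Lemma ob_rotE p x y q :
  P (p ++ [:: bar y, x & q]) <-> P (p ++ [:: x, y & q]).
Proof.
split; last exact: (ob_rot B).
by move=> /(ob_rot B)/(ob_rot B)/(ob_rot B); rewrite !barK.
Qed.

Lemma alternating_chi_of : alternating (chi_of P).
Proof.
apply: alternating_of_rot => [p x y q|s]; last exact/chi_of_opp/(ob_opp B).
apply: eq_chi_of; first exact: ob_rotE.
case/lastP: q => [|q z].
  rewrite !simplex_opp_cat /= -[in X in _ <-> X](barK x).
  by apply: iff_sym; exact: ob_rotE.
rewrite -!rcons_cons -!rcons_cat !simplex_opp_rcons !rcons_cat !rcons_cons.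
exact: ob_rotE.
Qed.

Lemma ob_uniq s : P s -> uniq (map star s).
Proof.
move=> /(realizes_chi_of P) chi1.
by apply: (alt_uniq alternating_chi_of); rewrite chi1.
Qed.

Lemma ob_sub_ground s : P s -> {subset map star s <= F}.
Proof. by move=> Ps e es; apply/(ob_ground B); exists s. Qed.

Lemma chi_of_C3 s x t : chi_of P (rcons s x) != 0 -> chi_of P t != 0 ->
  exists2 y, y \in t & chi_of P (rcons s y) != 0.
Proof.
move=> /chi_of_neq0 sx /chi_of_neq0 ht.
have [x' sx'] : exists x', P (rcons s x').
  by case: sx; [exists x|rewrite simplex_opp_rcons; exists (bar x)].
have [t' Pt' stt'] : exists2 t', P t' & map star t' = map star t.
  by case: ht => Pt; [exists t|exists (simplex_opp t); rewrite ?map_star_opp].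
have [y' y't' sy'] := ob_C3 B sx' Pt'.
have /mapP[y yt eyy'] : star y' \in map star t by rewrite -stt' map_f.
exists y => //; apply/chi_of_neq0; rewrite simplex_opp_rcons.
by case/star_eqP: eyy' sy' => ->; rewrite ?barK // => -[]; [right|left].
Qed.

Lemma chirotope_chi_of :
  satisfies_C4 r (chi_of P) -> chirotope_on F r (chi_of P).
Proof.
move=> C4; split; first split=> //.
- exact: alternating_chi_of.
- by move=> s; rewrite /chi_of; do 2!case: ifP => _ //.
- move=> s /chi_of_neq0[] /(ob_size B) // <-.
  by rewrite -(size_map star s) -map_star_opp size_map.
- exact: chi_of_C3.
move=> e; rewrite (ob_ground B); split=> -[s].
  by move=> Ps es; exists s => //; apply/chi_of_neq0; left.
move=> /chi_of_neq0[] Ps es; first by exists s.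
by exists (simplex_opp s); rewrite ?map_star_opp.
Qed.

End OrientedBasesTheory.

Lemma ob_ground_uniq F F' r P :
  oriented_bases F r P -> oriented_bases F' r P -> F = F'.
Proof.
move=> B B'; apply/setP => e.
apply/idP/idP; first by move/(ob_ground B)/(ob_ground B').
by move/(ob_ground B')/(ob_ground B).
Qed.

End OrientedBases.

(** * Rank 2: positions on the circle *)

Section ZpVal.

Context (n : nat) (n_gt1 : (1 < n)%N).
Implicit Types a b : 'Z_n.

Lemma Zp_ltn a : (val a < n)%N.
Proof. by have := ltn_ord a; rewrite [X in (_ < X)%N]Zp_cast. Qed.

Lemma Zp_valD a b : val (a + b) = ((val a + val b) %% n)%N.
Proof. by rewrite /=; congr (_ %% _)%N; exact: Zp_cast. Qed.

Lemma Zp_valN a : val (- a) = ((n - val a) %% n)%N.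
Proof. by rewrite /=; congr ((_ - _) %% _)%N; exact: Zp_cast. Qed.

Lemma Zp_valB a b :
  val (b - a) = (if val a <= val b then val b - val a else val b + n - val a)%N.
Proof.
rewrite Zp_valD Zp_valN modnDmr; have := Zp_ltn a; have := Zp_ltn b.
move: (val a) (val b) => i j ltj lti; case: leqP => ij.
  by rewrite (_ : j + (n - i) = (j - i) + n)%N ?modnDr ?modn_small; lia.
by rewrite modn_small; lia.
Qed.

Lemma Zp_val_nat k : (k < n)%N -> val (k%:R : 'Z_n) = k.
Proof.
by move=> ltk; rewrite -[LHS]/(nat_of_ord _) val_Zp_nat // modn_small.
Qed.

End ZpVal.

(* 2k points on a circle are numbered 0 .. 2k - 1; [antipode] and [precedes] are
   only meaningful on such numbers. *)
Definition antipode (k i : nat) : nat := (if i < k then i + k else i - k)%N.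

(* Point j is met strictly less than half a turn after point i. *)
Definition precedes (k i j : nat) : bool :=
  ((i < j < i + k) || (j + k < i))%N.

Definition precedes_sign (k i j : nat) : int :=
  if precedes k i j then 1 else if precedes k j i then -1 else 0.

Lemma Zp_val_half k (a : 'Z_(k.*2)) : (0 < k)%N ->
  val (a + k%:R) = antipode k (val a).
Proof.
move=> k0; have gt1 : (1 < k.*2)%N by lia.
rewrite /antipode Zp_valD // Zp_val_nat //; last by lia.
move: (val a) (Zp_ltn gt1 a) => i lti; case: ltnP => ik.
  by rewrite modn_small; lia.
by rewrite (_ : i + k = i - k + k.*2)%N ?modnDr ?modn_small; lia.
Qed.

Section Circle.

Context {k : nat}.
Implicit Types i j : nat.
Local Notation on_circle i := (i < k.*2)%N.

Lemma precedes_asym i j : on_circle i -> on_circle j ->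
  precedes k i j -> ~~ precedes k j i.
Proof. by rewrite /precedes; lia. Qed.

Lemma precedes_antipoder i j : on_circle i -> on_circle j ->
  precedes k i (antipode k j) = precedes k j i.
Proof. by rewrite /precedes /antipode; case: ifP; lia. Qed.

Lemma precedes_antipodel i j : on_circle i -> on_circle j ->
  precedes k (antipode k i) j = precedes k j i.
Proof. by rewrite /precedes /antipode; case: ifP; lia. Qed.

Lemma precedes_total i j : on_circle i -> on_circle j ->
  [|| i == j, j == antipode k i, precedes k i j | precedes k j i].
Proof. by rewrite /precedes /antipode; case: ifP; lia. Qed.

Lemma precedes_exchange i j j' : on_circle i -> on_circle j -> on_circle j' ->
  precedes k j j' ->
  (precedes k i j || precedes k j i) || (precedes k i j' || precedes k j' i).
Proof. by rewrite /precedes; lia. Qed.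

Lemma precedes_ex i : (1 < k)%N -> on_circle i ->
  exists2 j, on_circle j & precedes k i j.
Proof.
move=> k1 lti; exists (if i.+1 < k.*2 then i.+1 else 0)%N.
  by case: ifP; lia.
by rewrite /precedes; case: ifP; lia.
Qed.

(* Each alternative makes one of the premises of C4 fail on i, i', j1, j2. *)
Definition C4_obstruction i i' j1 j2 : bool :=
  [|| precedes k j1 i' && precedes k j2 i, precedes k i' j1 && precedes k i j2,
      precedes k j2 i' && precedes k i j1
    | precedes k i' j2 && precedes k j1 i].

Lemma C4_obstructionC i i' j1 j2 :
  C4_obstruction i' i j2 j1 = C4_obstruction i i' j1 j2.
Proof. by rewrite /C4_obstruction; do 8!case: precedes. Qed.

Lemma precedes_C4_obstruction i i' j1 j2 :
  on_circle i -> on_circle i' -> on_circle j1 -> on_circle j2 ->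
  precedes k i i' -> precedes k j2 j1 -> C4_obstruction i i' j1 j2.
Proof. by rewrite /C4_obstruction /precedes; lia. Qed.

Lemma precedes_sign1 i j : precedes k i j -> precedes_sign k i j = 1.
Proof. by rewrite /precedes_sign => ->. Qed.

Lemma precedes_signN i j : on_circle i -> on_circle j ->
  precedes_sign k j i = - precedes_sign k i j.
Proof.
move=> li lj; rewrite /precedes_sign.
have [/(precedes_asym li lj)/negPf-> //|_] := boolP (precedes k i j).
by case: ifP.
Qed.

Lemma precedes_sign_C4 i i' j1 j2 :
  on_circle i -> on_circle i' -> on_circle j1 -> on_circle j2 ->
  0 <= precedes_sign k j1 i' * precedes_sign k i j2 ->
  0 <= precedes_sign k j2 i' * - precedes_sign k i j1 ->
  0 <= precedes_sign k i i' * precedes_sign k j1 j2.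
Proof.
move=> li li' l1 l2 ge1 ge2.
have unobstructed : ~~ C4_obstruction i i' j1 j2.
  apply/negP => /or4P[] /andP[/precedes_sign1 s1 /precedes_sign1 s2];
    move: ge1 ge2.
  - by rewrite s1 (precedes_signN l2 li) s2.
  - by rewrite (precedes_signN li' l1) s1 s2.
  - by rewrite s1 s2.
  - by rewrite (precedes_signN li' l2) s1 (precedes_signN l1 li) s2.
rewrite {1 2}/precedes_sign.
case: ifP => [ii'|_]; [|case: ifP => [i'i|_]];
  case: ifP => [j12|_] //; try case: ifP => [j21|_] //.
- by rewrite precedes_C4_obstruction in unobstructed.
- by rewrite -C4_obstructionC precedes_C4_obstruction in unobstructed.
Qed.

End Circle.

Section HyperlineSequences2.

Context {E : finType}.
Implicit Types (x y : signed E) (s : seq (signed E)) (F : {set E}).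
Implicit Types Z : hseq2 E.

Lemma cyclic_order4_shift n (a b c d e : 'Z_n) :
  cyclic_order4 (a + e) (b + e) (c + e) (d + e) = cyclic_order4 a b c d.
Proof.
have subD u v : u + e - (v + e) = u - v :> 'Z_n.
  by rewrite opprD addrACA subrr addr0.
by rewrite /cyclic_order4 !subD.
Qed.

Lemma cyclic_order4_opp n (a b c d : 'Z_n) :
  cyclic_order4 a b c d -> cyclic_order4 (- a) (- d) (- c) (- b).
Proof.
have valN (u : 'Z_n) : (0 < val u)%N -> val (- u) = ((Zp_trunc n).+2 - val u)%N.
  by move=> u0; rewrite /= modn_small //; move: (ltn_ord u) u0 => /=; lia.
have subN u : - u - - a = - (u - a) :> 'Z_n by rewrite opprD.
rewrite /cyclic_order4 !subN => /andP[/andP[b0 bc] cd].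
have c0 := leq_ltn_trans (leq0n _) bc.
have d0 := leq_ltn_trans (leq0n _) cd.
rewrite !valN //.
have ltZ (u : 'Z_n) : (val u < (Zp_trunc n).+2)%N := ltn_ord u.
move: (val (b - a)) (val (c - a)) (val (d - a)) (ltZ (b - a)) (ltZ (c - a))
  (ltZ (d - a)) b0 bc cd => *; lia.
Qed.

Lemma hseq2_posbase_shift Z c s :
  hseq2_posbase (hseq2_shift Z c) s <-> hseq2_posbase Z s.
Proof.
split=> -[x1 [x2 [-> ninc [a1 [a2 [a3 [a4 [in1 in2 in3 in4 cyc]]]]]]]];
  exists x1, x2; split=> //.
- case=> a [i1 i2]; apply: ninc; exists (a - c : 'Z_((half_period Z).*2)).
  by rewrite /incident !ffunE subrK.
- exists (a1 + c), (a2 + c), (a3 + c), (a4 + c).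
  by move: in1 in2 in3 in4; rewrite !ffunE cyclic_order4_shift.
- case=> a; rewrite /incident !ffunE => -[i1 i2]; apply: ninc.
  by exists (a + c).
- exists (a1 - c : 'Z_((half_period Z).*2)), (a2 - c), (a3 - c), (a4 - c).
  by rewrite !ffunE !subrK cyclic_order4_shift.
Qed.

Lemma hseq2_oppK : involutive (@hseq2_opp E).
Proof. by case=> k A; congr Hseq2; apply/ffunP => a; rewrite !ffunE opprK. Qed.

Lemma hseq2_posbase_opp Z s :
  hseq2_posbase (hseq2_opp Z) s <-> hseq2_posbase Z (simplex_opp s).
Proof.
have imp Z' s' :
    hseq2_posbase (hseq2_opp Z') s' -> hseq2_posbase Z' (simplex_opp s').
  case=> [x1 [x2 [-> ninc [a1 [a2 [a3 [a4 [in1 in2 in3 in4 cyc]]]]]]]].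
  exists x1, (bar x2); split=> //.
    case=> a [i1 i2]; apply: ninc; exists (- a : 'Z_((half_period Z').*2)).
    by rewrite /incident !ffunE opprK; rewrite star_bar in i2.
  exists (- a1), (- a4), (- a3), (- a2).
  move: in1 in2 in3 in4; rewrite !ffunE barK; split=> //.
  exact: cyclic_order4_opp.
split; first exact: imp.
by rewrite -{1}[Z]hseq2_oppK => /imp; rewrite simplex_oppK.
Qed.

Lemma hseq2_eq_refl Z : hseq2_eq Z Z.
Proof.
exists 0; case: Z => k A; congr Hseq2.
by apply/ffunP => a; rewrite ffunE addr0.
Qed.

Lemma hseq2_eq_oppK Z : hseq2_eq Z (hseq2_opp (hseq2_opp Z)).
Proof. by rewrite hseq2_oppK; exact: hseq2_eq_refl. Qed.

Lemma hseq2_eq_opp Z Z' :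
  hseq2_eq Z Z' -> hseq2_eq (hseq2_opp Z) (hseq2_opp Z').
Proof.
case=> c ->; exists (- c : 'Z_((half_period Z).*2)); congr Hseq2.
by apply/ffunP => a; rewrite !ffunE opprD opprK.
Qed.

Lemma hseq2_eq_posbase Z Z' s :
  hseq2_eq Z Z' -> hseq2_posbase Z s <-> hseq2_posbase Z' s.
Proof. by case=> c ->; rewrite hseq2_posbase_shift. Qed.

Lemma is_hseq2_opp F Z : is_hseq2 F Z -> is_hseq2 F (hseq2_opp Z).
Proof.
case=> k2 atoms1 atom_half cover_atoms disj; split=> //=.
- by move=> a; rewrite ffunE; exact: atoms1.
- move=> a; rewrite !ffunE -atom_half opprD; congr (atom Z (_ + _)).
  apply/esym/eqP; rewrite -subr_eq0 opprK -natrD addnn.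
  by apply/eqP/pchar_Zp; lia.
- rewrite -cover_atoms (reindex_inj (@oppr_inj _)) /=.
  by apply: eq_bigr => a _; rewrite ffunE opprK.
- by move=> a b ab; rewrite !ffunE; apply: disj; rewrite eqr_opp.
Qed.

Lemma hseq2_posbase_size Z s : hseq2_posbase Z s -> size s = 2%N.
Proof. by case=> x [y []] ->. Qed.

(* The index of the atom containing x, and 0 if there is none. *)
Definition position Z x : nat := val (odflt 0 [pick a | x \in atom Z a]).

Section Positions.

Context {F : {set E}} {Z : hseq2 E} (hZ : is_hseq2 F Z).
Local Notation k := (half_period Z).
Local Notation pos := (position Z).

Lemma hseq2_period_gt1 : (1 < k.*2)%N.
Proof. by case: hZ => k2 *; lia. Qed.

Lemma position_lt x : (pos x < k.*2)%N.
Proof. exact: Zp_ltn hseq2_period_gt1 _. Qed.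

Lemma atom_inj x a b : x \in atom Z a -> x \in atom Z b -> a = b.
Proof.
case: hZ => _ _ _ _ dis xa xb; apply/eqP/contraT => /dis.
by move/disjointFr/(_ xa); rewrite xb.
Qed.

Lemma position_atom x a : x \in atom Z a -> pos x = val a.
Proof.
rewrite /position => xa; case: pickP => [b xb|/(_ a)]; last by rewrite xa.
by rewrite (atom_inj xb xa).
Qed.

Lemma atom_ground x a : x \in atom Z a -> star x \in F.
Proof.
case: hZ => _ _ _ /setP/(_ x); rewrite inE => <- _ xa.
by apply/bigcupP; exists a.
Qed.

Lemma atom_ex x : star x \in F -> exists a, x \in atom Z a.
Proof.
case: hZ => _ _ _ /setP/(_ x); rewrite inE => <- _ /bigcupP[a _ xa].
by exists a.
Qed.

Lemma position_surj i : (i < k.*2)%N -> exists2 x, star x \in F & pos x = i.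
Proof.
move=> lti; case: (hZ) => _ /(_ i%:R)[/set0Pn[x xi] _ _] _ _ _.
exists x; first exact: atom_ground xi.
by rewrite (position_atom xi) Zp_val_nat // hseq2_period_gt1.
Qed.

Lemma atom_bar x a : (bar x \in atom Z (a + k%:R)) = (x \in atom Z a).
Proof. by case: hZ => _ _ -> _ _; rewrite mem_barset barK. Qed.

Lemma val_antipode (a : 'Z_(k.*2)) : val (a + k%:R) = antipode k (val a).
Proof. by apply: Zp_val_half; case: hZ => k2 *; lia. Qed.

Lemma position_bar x : star x \in F -> pos (bar x) = antipode k (pos x).
Proof.
move=> /atom_ex[a xa]; rewrite (position_atom xa) -val_antipode.
by apply: position_atom; rewrite atom_bar.
Qed.

Lemma incident_position x a : incident Z (star x) a ->
  pos x = val a \/ pos x = antipode k (val a).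
Proof.
rewrite /incident mem_starset_star => /orP[] xa.
  by left; exact: position_atom.
right; rewrite -val_antipode; apply: position_atom.
by rewrite -[x]barK atom_bar.
Qed.

Lemma hseq2_posbaseP x y : hseq2_posbase Z [:: x; y] <->
  [/\ star x \in F, star y \in F & precedes k (pos x) (pos y)].
Proof.
have gt1 := hseq2_period_gt1.
have cycE (a b : 'Z_(k.*2)) : cyclic_order4 a b (a + k%:R) (b + k%:R) =
                precedes k (val a) (val b).
  rewrite /cyclic_order4 /precedes !Zp_valB // !val_antipode /antipode.
  have := Zp_ltn gt1 a; have := Zp_ltn gt1 b.
  by move: (val a) (val b) => i j *; do !case: ifP; lia.
split.
  case=> _ [_ [[<- <-] _ [a [b [c [d [xa yb xc yd cyc]]]]]]].
  split; [exact: atom_ground xa|exact: atom_ground yb|].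
  rewrite (position_atom xa) (position_atom yb) -cycE.
  move: xa yb; rewrite -atom_bar => /(atom_inj xc) <-.
  by rewrite -atom_bar => /(atom_inj yd) <-.
move=> [/atom_ex[a xa] /atom_ex[b yb]].
rewrite (position_atom xa) (position_atom yb) => pr; exists x, y; split=> //.
  case=> c [/incident_position x_at /incident_position y_at].
  move: pr x_at y_at; rewrite (position_atom xa) (position_atom yb).
  have := Zp_ltn gt1 a; have := Zp_ltn gt1 b; have := Zp_ltn gt1 c.
  rewrite /precedes /antipode.
  by move: (val a) (val b) (val c) => i j l; case: ifP; lia.
by exists a, b, (a + k%:R), (b + k%:R); rewrite cycE !atom_bar.
Qed.

Lemma hseq2_posbase_or_bar x y : star x \in F -> star y \in F ->
  precedes k (pos x) (pos y) || precedes k (pos y) (pos x) ->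
  hseq2_posbase Z [:: x; y] \/ hseq2_posbase Z [:: x; bar y].
Proof.
have lt := position_lt; move=> xF yF /orP[].
  by left; exact/hseq2_posbaseP.
rewrite -precedes_antipoder // -position_bar // => prec.
by right; apply/hseq2_posbaseP; rewrite star_bar.
Qed.

Lemma hseq2_oriented_bases : oriented_bases F 2 (hseq2_posbase Z).
Proof.
have lt := position_lt; split.
- exact: hseq2_posbase_size.
- move=> e; split=> [eF|[s Ps]].
    have k1 : (1 < k)%N by case: hZ.
    have [j ltj] := precedes_ex k1 (lt (inl e)).
    have [y yF <-] := position_surj ltj => prec.
    by exists [:: inl e; y]; [exact/hseq2_posbaseP|rewrite inE eqxx].
  case: s Ps (hseq2_posbase_size Ps) => [|x [|y []]] //=.
  move=> /hseq2_posbaseP[xF yF _] _.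
  by rewrite !inE => /orP[] /eqP->.
- move=> p x y q Ps; have := hseq2_posbase_size Ps.
  rewrite size_cat /= !addnS => -[/eqP]; rewrite addn_eq0 !size_eq0.
  case/andP=> /eqP p0 /eqP q0; rewrite {}p0 {}q0 cat0s in Ps *.
  have /hseq2_posbaseP[xF yF xy] := Ps; apply/hseq2_posbaseP.
  by rewrite star_bar position_bar // precedes_antipodel.
- move=> s Ps; case: s Ps (hseq2_posbase_size Ps) => [|x [|y []]] //=.
  move=> /hseq2_posbaseP[xF yF xy] _ /hseq2_posbaseP[_ _].
  rewrite position_bar // precedes_antipoder //.
  by rewrite (negPf (precedes_asym _ _ xy)).
- move=> s x t Ps Pt; have := hseq2_posbase_size Pt.
  have := hseq2_posbase_size Ps; rewrite size_rcons.
  case: s t Ps Pt => [|x1 [|]] [|y1 [|y2 []]] //=.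
  move=> /hseq2_posbaseP[x1F _ _] /hseq2_posbaseP[y1F y2F y12] _ _.
  case/orP: (precedes_exchange (lt x1) (lt y1) (lt y2) y12) => prec.
    by exists y1; rewrite ?inE ?eqxx //; exact: hseq2_posbase_or_bar.
  by exists y2; rewrite ?inE ?eqxx ?orbT //; exact: hseq2_posbase_or_bar.
Qed.

Lemma chi_of_hseq2 x y : star x \in F -> star y \in F ->
  chi_of (hseq2_posbase Z) [:: x; y] = precedes_sign k (pos x) (pos y).
Proof.
move=> xF yF; have base z : star z \in F ->
    `[< hseq2_posbase Z [:: x; z] >] = precedes k (pos x) (pos z).
  move=> zF; apply/asboolP/idP => [/hseq2_posbaseP[] //|prec].
  exact/hseq2_posbaseP.
rewrite /chi_of /= !base ?star_bar //.
by rewrite position_bar // precedes_antipoder ?position_lt.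
Qed.

Lemma chirotope_hseq2 : chirotope_on F 2 (chi_of (hseq2_posbase Z)).
Proof.
have B := hseq2_oriented_bases; apply: (chirotope_chi_of B).
move=> [|//] x x' y1 y2 _; rewrite !cat0s.
have ground u v : chi_of (hseq2_posbase Z) [:: u; v] != 0 ->
    star u \in F /\ star v \in F.
  move=> /chi_of_neq0[] /(ob_sub_ground B) sub.
    by rewrite !sub // !inE eqxx ?orbT.
  by rewrite map_star_opp in sub; rewrite !sub // !inE eqxx ?orbT.
have [->|] := eqVneq (chi_of (hseq2_posbase Z) [:: x; x']) 0.
  by rewrite mul0r.
have [->|] := eqVneq (chi_of (hseq2_posbase Z) [:: y1; y2]) 0.
  by rewrite mulr0.
move=> /ground[y1F y2F] /ground[xF x'F].
rewrite (@chi_of_opp _ _ [:: x; y1]); last exact: (ob_opp B).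
by rewrite !chi_of_hseq2 //; apply: precedes_sign_C4; exact: position_lt.
Qed.

End Positions.

End HyperlineSequences2.

(** * All ranks: from hyperline sequences to chirotopes *)

Section RankLaws.

Context {E : finType}.
Implicit Types (F : {set E}) (s t u v : seq (signed E)).

Record rank_laws (n : nat) (D : rank_data E) : Prop := RankLaws {
  rl_eq_refl : forall X : rd_type D, rd_eq X X;
  rl_eq_oppK : forall X : rd_type D, rd_eq X (rd_opp (rd_opp X));
  rl_eq_posbase : forall (X X' : rd_type D) s,
    rd_eq X X' -> rd_posbase X s <-> rd_posbase X' s;
  rl_posbase_opp : forall (X : rd_type D) s,
    rd_posbase (rd_opp X) s <-> rd_posbase X (simplex_opp s);
  rl_is_hseq_opp : forall F (X : rd_type D),
    rd_is_hseq F X -> rd_is_hseq F (rd_opp X);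
  rl_posbase_ex : forall F (X : rd_type D),
    rd_is_hseq F X -> exists s, rd_posbase X s;
  rl_oriented_bases : forall F (X : rd_type D),
    rd_is_hseq F X -> oriented_bases F n (rd_posbase X)
}.

Lemma is_hseq1_barN F (X : {set signed E}) x :
  is_hseq1 F X -> x \in X -> bar x \notin X.
Proof.
case=> _ /esym/eqP/imset_injP inj _ xX; apply/negP => bX.
by have := inj _ _ bX xX (star_bar x); case: x {xX bX}.
Qed.

Lemma is_hseq1_opp F (X : {set signed E}) :
  is_hseq1 F X -> is_hseq1 F (barset X).
Proof.
case=> /set0Pn[x xX] cX eF; split; rewrite ?starset_barset //.
  by apply/set0Pn; exists (bar x); rewrite mem_barset barK.
by rewrite -cX card_imset //; exact: inv_inj barK.
Qed.

Lemma hseq1_posbase_opp (X : {set signed E}) s :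
  hseq1_posbase (barset X) s <-> hseq1_posbase X (simplex_opp s).
Proof.
split=> -[x xX]; first by move=> ->; exists (bar x); rewrite // -mem_barset.
move=> es; exists (bar x); first by rewrite mem_barset barK.
by rewrite -[s]simplex_oppK es.
Qed.

Lemma hseq1_oriented_bases F (X : {set signed E}) :
  is_hseq1 F X -> oriented_bases F 1 (hseq1_posbase X).
Proof.
move=> hX; split.
- by move=> s [x _ ->].
- case: hX => _ _ <- e; split=> [/imsetP[x xX ->]|[_ [x xX ->]]].
    by exists [:: x]; [exists x|rewrite inE eqxx].
  by rewrite inE => /eqP->; rewrite mem_starset_star xX.
- by move=> [|a [|b p]] x y q [].
- move=> s [x xX ->] [y yX [exy]].
  by move: (is_hseq1_barN hX xX); rewrite exy yX.
- move=> s x t [z zX es] [y yX ->]; exists y; rewrite ?inE //.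
  by left; exists y => //; case: s es => // a [].
Qed.

Lemma rank_laws1 : rank_laws 1 (rank1 E).
Proof.
split=> //=.
- by move=> X; apply/setP => x; rewrite !mem_barset barK.
- by move=> X X' s ->.
- exact: hseq1_posbase_opp.
- exact: is_hseq1_opp.
- by move=> F X [/set0Pn[x xX] _ _]; exists [:: x], x.
- exact: hseq1_oriented_bases.
Qed.

Lemma hseq2_posbase_ex F (Z : hseq2 E) :
  is_hseq2 F Z -> exists s, hseq2_posbase Z s.
Proof.
move=> hZ; have := ltnW (hseq2_period_gt1 hZ).
move=> /(position_surj hZ)[x + _].
by move=> /(ob_ground (hseq2_oriented_bases hZ))[s Ps _]; exists s.
Qed.

Lemma rank_laws2 : rank_laws 2 (rank2 E).
Proof.
split=> /=.
- exact: hseq2_eq_refl.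
- exact: hseq2_eq_oppK.
- exact: hseq2_eq_posbase.
- exact: hseq2_posbase_opp.
- exact: is_hseq2_opp.
- exact: hseq2_posbase_ex.
- by move=> F Z; exact: hseq2_oriented_bases.
Qed.

Lemma take_drop_opp n s : (n < size s)%N ->
  take n (simplex_opp s) = take n s /\
  drop n (simplex_opp s) = simplex_opp (drop n s).
Proof.
move=> ltn; rewrite -{1 3}(cat_take_drop n s).
have := size_drop n s; have := size_takel (ltnW ltn).
case: (drop n s) => [|x v] st sd; first by move: sd ltn => /=; lia.
by rewrite simplex_opp_cat take_size_cat ?drop_size_cat.
Qed.

Lemma size_cat_pair n s : size s = n.+2 -> exists u x y, s = u ++ [:: x; y].
Proof.
case/lastP: s => [|s y] //; case/lastP: s => [|u x] // _.
by exists u, x, y; rewrite -cats1 cat_rcons.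
Qed.

Section RankUp.

Context {n : nat} {D : rank_data E} (RL : rank_laws n D).
Implicit Types (X : hyperlines D) (Y : rd_type D) (Z : hseq2 E).

Lemma hyperlines_eq_refl X : hyperlines_eq X X.
Proof.
have eqY := rl_eq_refl RL; have eqZ := @hseq2_eq_refl E.
by split=> Y Z XYZ; exists Y, Z.
Qed.

Lemma hyperlines_eq_oppK X :
  hyperlines_eq X (hyperlines_opp (hyperlines_opp X)).
Proof.
have eqY := rl_eq_refl RL; have eqZ := @hseq2_eq_refl E.
split=> [Y Z XYZ|Y _ [_ [Z XYZ ->] ->]]; exists Y, Z; rewrite ?hseq2_oppK //.
by split=> //; exists (hseq2_opp Z); [exists Z|rewrite hseq2_oppK].
Qed.

Lemma hyperlines_eq_posbase X X' s : hyperlines_eq X X' ->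
  hyperlines_posbase n X s <-> hyperlines_posbase n X' s.
Proof.
case=> XX' X'X; split=> -[os [Y [Z [XYZ pY pZ]]]]; split=> //.
  have [Y' [Z' [XYZ' eY eZ]]] := XX' _ _ XYZ; exists Y', Z'; split=> //.
    exact/(rl_eq_posbase RL _ eY).
  exact/(hseq2_eq_posbase _ eZ).
have [Y' [Z' [XYZ' eY eZ]]] := X'X _ _ XYZ; exists Y', Z'; split=> //.
  exact/(rl_eq_posbase RL _ eY).
exact/(hseq2_eq_posbase _ eZ).
Qed.

Lemma hyperlines_posbase_opp X s : hyperlines_posbase n (hyperlines_opp X) s <->
  hyperlines_posbase n X (simplex_opp s).
Proof.
rewrite /hyperlines_posbase (@oriented_perm_star _ _ (simplex_opp s) s);
  last by rewrite map_star_opp.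
have takedrop : oriented n.+2 s -> take n (simplex_opp s) = take n s /\
    drop n (simplex_opp s) = simplex_opp (drop n s).
  by case/andP=> /eqP ss _; apply: take_drop_opp; rewrite ss.
split=> -[os]; have [-> ->] := takedrop os.
  case=> Y [_ [[Z XYZ ->] pY pZ]]; split=> //; exists Y, Z; split=> //.
  exact/hseq2_posbase_opp.
case=> Y [Z [XYZ pY pZ]]; split=> //; exists Y, (hseq2_opp Z); split=> //.
  by exists Z.
exact/hseq2_posbase_opp.
Qed.

Lemma is_hyperlines_opp F X :
  is_hyperlines n F X -> is_hyperlines n F (hyperlines_opp X).
Proof.
case=> -[Y0 [Z0 XYZ0]] H1 H2 H3 H4; have opp := hyperlines_posbase_opp X.
split.
- by exists Y0, (hseq2_opp Z0), Z0.
- move=> Y _ [Z XYZ ->]; have [FY [FZ [hY hZ eF dis]]] := H1 _ _ XYZ.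
  by exists FY, FZ; split=> //; exact: is_hseq2_opp.
- move=> Y1 _ Y2 _ FY2 s [Z1 XYZ1 ->] [Z2 XYZ2 ->] p1 hY2 sub.
  by case: (H2 _ _ _ _ _ _ XYZ1 XYZ2 p1 hY2 sub) => -[eY eZ]; [left|right];
    split=> //; exact: hseq2_eq_opp.
- move=> s x t /opp; rewrite simplex_opp_rcons => ps /opp pt.
  have [y yt sy] := H3 _ _ _ ps pt.
  have /mapP[z zt eyz] : star y \in map star t by rewrite -map_star_opp map_f.
  exists z => //; rewrite !opp !simplex_opp_rcons.
  by case/star_eqP: eyz sy => ->; rewrite ?barK // => -[]; [right|left].
- by move=> p x y z; rewrite !opp !simplex_opp_cat; exact: H4.
Qed.

Section Hyperlines.

Context {F : {set E}} {X : hyperlines D} (hX : is_hyperlines n F X).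

Lemma hyperlines_posbaseP u x y : hyperlines_posbase n X (u ++ [:: x; y]) <->
  exists Y Z, [/\ X Y Z, rd_posbase Y u & hseq2_posbase Z [:: x; y]].
Proof.
split=> [[/andP[/eqP + _] [Y [Z [XYZ]]]]|[Y [Z [XYZ pY pZ]]]].
  rewrite size_cat addn2 => -[su].
  by rewrite take_size_cat // drop_size_cat //; exists Y, Z.
have [FY [FZ [hY hZ _ dis]]] := hyperlines_H1 hX XYZ.
have BY := rl_oriented_bases RL hY; have BZ := hseq2_oriented_bases hZ.
have su := ob_size BY pY; split; last first.
  by exists Y, Z; rewrite take_size_cat // drop_size_cat.
rewrite /oriented size_cat su addn2 eqxx map_cat cat_uniq.
rewrite (ob_uniq BY pY) (ob_uniq BZ pZ) andbT.
apply/hasPn => e /(ob_sub_ground BZ pZ) eZ; apply/negP.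
by move=> /(ob_sub_ground BY pY) /(disjointFr dis); rewrite eZ.
Qed.

(* By H2 the hyperline through a positive base of Y is unique up to sign. *)
Lemma hyperlines_posbase_cat Y Z u x y : X Y Z -> rd_posbase Y u ->
  hyperlines_posbase n X (u ++ [:: x; y]) <-> hseq2_posbase Z [:: x; y].
Proof.
move=> XYZ pY; split=> [|pZ]; last by apply/hyperlines_posbaseP; exists Y, Z.
case/hyperlines_posbaseP=> Y' [Z' [XYZ' pY' pZ']].
have [FY' [_ [hY' _ _ _]]] := hyperlines_H1 hX XYZ'.
have BY' := rl_oriented_bases RL hY'.
have := hyperlines_H2 hX XYZ XYZ' pY hY' (ob_sub_ground BY' pY').
case=> -[eY eZ]; first exact/(hseq2_eq_posbase _ eZ).
have /(rl_posbase_opp RL) := (rl_eq_posbase RL _ eY).1 pY.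
by move/(ob_opp BY' pY').
Qed.

Lemma hyperlines_posbase_ground e :
  e \in F <-> exists2 s, hyperlines_posbase n X s & e \in map star s.
Proof.
split=> [|[s /[dup] Ps [/andP[/eqP ss _] _] es]]; last first.
  have [u [x [y def_s]]] := size_cat_pair ss; rewrite def_s in Ps es.
  have [Y [Z [XYZ pY pZ]]] := (hyperlines_posbaseP u x y).1 Ps.
  have [FY [FZ [hY hZ -> _]]] := hyperlines_H1 hX XYZ.
  move: es; rewrite map_cat mem_cat in_setU; case/orP.
    by move/(ob_sub_ground (rl_oriented_bases RL hY) pY)=> ->.
  by move/(ob_sub_ground (hseq2_oriented_bases hZ) pZ)=> ->; rewrite orbT.
have [Y [Z XYZ]] := hyperlines_nonempty hX.
have [FY [FZ [hY hZ -> _]]] := hyperlines_H1 hX XYZ.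
have BZ := hseq2_oriented_bases hZ.
have glue u v : rd_posbase Y u -> hseq2_posbase Z v ->
    e \in map star u ++ map star v ->
    exists2 s, hyperlines_posbase n X s & e \in map star s.
  move=> pY pZ euv; exists (u ++ v); last by rewrite map_cat.
  case: v pZ {euv} (ob_size BZ pZ) => [|x [|y []]] // pZ _.
  exact/(hyperlines_posbase_cat _ _ XYZ pY).
rewrite in_setU => /orP[/(ob_ground (rl_oriented_bases RL hY))|/(ob_ground BZ)].
  case=> u pY eu; have [v pZ] := hseq2_posbase_ex hZ.
  by apply: (glue u v) => //; rewrite mem_cat eu.
case=> v pZ ev; have [u pY] := rl_posbase_ex RL hY.
by apply: (glue u v) => //; rewrite mem_cat ev orbT.
Qed.

Lemma hyperlines_posbase_rot p x y q :
  hyperlines_posbase n X (p ++ [:: x, y & q]) ->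
  hyperlines_posbase n X (p ++ [:: bar y, x & q]).
Proof.
case/lastP: q => [|q z].
  case/hyperlines_posbaseP=> Y [Z [XYZ pY pZ]].
  have [_ [FZ [_ hZ _ _]]] := hyperlines_H1 hX XYZ.
  apply/(hyperlines_posbase_cat _ _ XYZ pY).
  exact: (ob_rot (hseq2_oriented_bases hZ) (p := [::])).
case/lastP: q => [|q z']; first exact: hyperlines_H4 hX _ _ _ _.
have shape a b : p ++ [:: a, b & rcons (rcons q z') z] =
    (p ++ [:: a, b & q]) ++ [:: z'; z].
  by rewrite -catA /= -[rcons (rcons _ _) _]cats1 cat_rcons.
rewrite !shape => /hyperlines_posbaseP[Y [Z [XYZ pY pZ]]].
have [FY [_ [hY _ _ _]]] := hyperlines_H1 hX XYZ.
apply/hyperlines_posbaseP; exists Y, Z; split=> //.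
exact: ob_rot (rl_oriented_bases RL hY) _ _ _ _ pY.
Qed.

Lemma hyperlines_oriented_bases :
  oriented_bases F n.+2 (hyperlines_posbase n X).
Proof.
split.
- by move=> s [/andP[/eqP]].
- exact: hyperlines_posbase_ground.
- exact: hyperlines_posbase_rot.
- move=> s Ps; have /size_cat_pair[u [x [y def_s]]] : size s = n.+2.
    by case: Ps => /andP[/eqP].
  rewrite def_s in Ps *; rewrite simplex_opp_cat /=.
  have [Y [Z [XYZ pY pZ]]] := (hyperlines_posbaseP u x y).1 Ps.
  have [_ [FZ [_ hZ _ _]]] := hyperlines_H1 hX XYZ.
  move=> /(hyperlines_posbase_cat _ _ XYZ pY).
  exact: (ob_opp (hseq2_oriented_bases hZ) pZ).
- exact: hyperlines_H3 hX.
Qed.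

Lemma chirotope_hyperlines :
  chirotope_on F n.+2 (chi_of (hyperlines_posbase n X)).
Proof.
apply: (chirotope_chi_of hyperlines_oriented_bases) => p x x' y1 y2 _.
have [[Y [Z [XYZ pY]]]|noY] :=
    pselect (exists Y Z, X Y Z /\ rd_posbase Y p).
  have [_ [FZ [_ hZ _ _]]] := hyperlines_H1 hX XYZ.
  have chiE a b : chi_of (hyperlines_posbase n X) (p ++ [:: a; b]) =
                  chi_of (hseq2_posbase Z) [:: a; b].
    by apply: eq_chi_of; rewrite ?simplex_opp_cat /=;
      exact: (hyperlines_posbase_cat _ _ XYZ pY).
  by rewrite !chiE; exact: (pc2_C4 (chirotope_hseq2 hZ)).
suff -> : chi_of (hyperlines_posbase n X) (p ++ [:: x; x']) = 0.
  by rewrite mul0r.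
apply/eqP; apply: contra_notT noY => /chi_of_neq0; rewrite simplex_opp_cat /=.
by case=> /hyperlines_posbaseP[Y [Z [XYZ pY _]]]; exists Y, Z.
Qed.

End Hyperlines.

Lemma rank_laws_up : rank_laws n.+2 (rank_up n D).
Proof.
split=> /=.
- exact: hyperlines_eq_refl.
- exact: hyperlines_eq_oppK.
- exact: hyperlines_eq_posbase.
- exact: hyperlines_posbase_opp.
- exact: is_hyperlines_opp.
- move=> F X hX; have [Y [Z XYZ]] := hyperlines_nonempty hX.
  have [FY [FZ [hY hZ _ _]]] := hyperlines_H1 hX XYZ.
  have [u pY] := rl_posbase_ex RL hY; have [v pZ] := hseq2_posbase_ex hZ.
  exists (u ++ v); case: v pZ (hseq2_posbase_size pZ) => [|x [|y []]] // pZ _.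
  exact/(hyperlines_posbase_cat hX _ _ XYZ pY).
- by move=> F X; exact: hyperlines_oriented_bases.
Qed.

End RankUp.

Lemma rank_laws_datum r : (0 < r)%N -> rank_laws r (rank_datum E r).
Proof.
elim/ltn_ind: r => -[|[|[|q]]] IH // _.
- exact: rank_laws1.
- exact: rank_laws2.
- by apply: rank_laws_up; exact: IH.
Qed.

Theorem chirotope_hseq r F (X : hseq E r) :
  is_hseq F X -> chirotope_on F r (chi_of (hseq_posbase X)).
Proof.
case: r X => [|[|[|q]]] X // hX.
- by apply: (chirotope_chi_of (hseq1_oriented_bases hX)) => p x x' y1 y2 [].
- exact: chirotope_hseq2.
- by apply: chirotope_hyperlines hX; exact: rank_laws_datum.
Qed.

End RankLaws.

(** * From chirotopes of rank 2 to hyperline sequences *)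

Section Rank2Chirotopes.

Context {E : finType}.
Implicit Types (x y z : signed E) (t : seq (signed E)).
Implicit Types chi : seq (signed E) -> int.

Section Plucker.

Context {chi : seq (signed E) -> int} (H : prechirotope 2 chi).
Local Notation c x y := (chi [:: x; y]).

(* The three-term relation, when its term in c a a' vanishes. *)
Lemma pc2_plucker0 a a' y y' : c a a' = 0 -> c a y * c a' y' = c a y' * c a' y.
Proof.
move=> aa0.
have le0 u v : c a u * c a' v <= 0 -> c a v * c a' u <= 0.
  move=> uv; have : 0 <= c u a' * c a v.
    apply: (pc2_C4 H); first by rewrite aa0 mul0r.
    rewrite (pc2_barr H) (pc2_swap H a') (pc2_swap H a).
    by rewrite opprK mulNr oppr_ge0 mulrC.
  by rewrite (pc2_swap H a') mulNr oppr_ge0 mulrC.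
have ge0 u v : 0 <= c a u * c a' v -> 0 <= c a v * c a' u.
  by have := le0 (bar u) v; rewrite !(pc2_barr H) mulNr mulrN !oppr_le0.
have range u v : c a u * c a' v \in [:: -1; 0; 1].
  have := pc_range H [:: a; u]; have := pc_range H [:: a'; v].
  by rewrite !inE => /or3P[] /eqP-> /or3P[] /eqP->.
move: (le0 y y') (ge0 y y') (le0 y' y) (ge0 y' y) (range y y') (range y' y).
move: (c a y * c a' y') (c a y' * c a' y) => u v; rewrite !inE.
by move=> le_uv ge_uv le_vu ge_vu /or3P[] /eqP eu /or3P[] /eqP ev;
  subst u v; lia.
Qed.

Lemma pc2_exchange x y u v :
  c x y != 0 -> c u v != 0 -> (c x u != 0) || (c x v != 0).
Proof.
move=> xy uv; apply: contraTT (mulf_neq0 xy uv); rewrite negb_or !negbK.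
by move=> /andP[/eqP/pc2_plucker0-> /eqP->]; rewrite mul0r.
Qed.

End Plucker.

Section Proportional.

Context {chi chi' : seq (signed E) -> int}.
Context (H : prechirotope 2 chi) (H' : prechirotope 2 chi').
Context (supp : forall x y, (chi [:: x; y] != 0) = (chi' [:: x; y] != 0)).
Context (plucker : forall z y y',
  chi [:: z; y] * chi' [:: z; y'] = chi [:: z; y'] * chi' [:: z; y]).

(* On the common support the values are signs, hence the name. *)
Local Notation ratio x y := (chi [:: x; y] * chi' [:: x; y]).

Lemma pc2_ratio_const x y u v : chi [:: x; y] != 0 -> chi [:: u; v] != 0 ->
  ratio x y = ratio u v.
Proof.
have ratioC z z' : ratio z' z = ratio z z'.
  by rewrite (pc2_swap H) (pc2_swap H') mulrNN.
have moveR z z1 z2 : chi [:: z; z1] != 0 -> chi [:: z; z2] != 0 ->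
    ratio z z1 = ratio z z2.
  move=> nz1 nz2; have nz1' := nz1; have nz2' := nz2; rewrite supp in nz1'.
  rewrite supp in nz2'; move: (plucker z z1 z2).
  by case: (pc_neq0P H nz1) => ->; case: (pc_neq0P H nz2) => ->;
    case: (pc_neq0P H' nz1') => ->; case: (pc_neq0P H' nz2') => ->.
have moveL z z1 z2 : chi [:: z1; z] != 0 -> chi [:: z2; z] != 0 ->
    ratio z1 z = ratio z2 z.
  move=> nz1 nz2; rewrite (ratioC z z1) (ratioC z z2).
  by apply: moveR; rewrite (pc2_swap H) oppr_eq0.
move=> xy uv; case/orP: (pc2_exchange H xy uv) => [xu|xv].
  rewrite (moveR _ _ _ xy xu) ratioC; apply: moveR => //.
  by rewrite (pc2_swap H) oppr_eq0.
by rewrite (moveR _ _ _ xy xv); exact: moveL.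
Qed.

Lemma pc2_proportional :
  (forall t, chi t = chi' t) \/ (forall t, chi t = - chi' t).
Proof.
have supp0 x y : chi [:: x; y] = 0 -> chi' [:: x; y] = 0.
  by move=> xy0; apply/eqP; rewrite -[_ == _]negbK -supp xy0 eqxx.
have extend sg : (forall x y, chi [:: x; y] = sg * chi' [:: x; y]) ->
    forall t, chi t = sg * chi' t.
  move=> pairs t; have [t2|nt2] := eqVneq (size t) 2%N.
    by case: t t2 => [|x [|y []]].
  have /eqP-> : chi t == 0 by apply: contraNT nt2 => /(pc_size H)->.
  have /eqP-> : chi' t == 0 by apply: contraNT nt2 => /(pc_size H')->.
  by rewrite mulr0.
have [/existsP[u /existsP[v uv]]|/existsPn zero] :=
    boolP [exists u, exists v, chi [:: u; v] != 0]; last first.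
  left=> t; rewrite (extend 1) ?mul1r // => x y; rewrite mul1r.
  by have /existsPn/(_ y)/negbNE/eqP xy0 := zero x; rewrite xy0 supp0.
have {}extend : forall t, chi t = ratio u v * chi' t.
  apply: extend => x y; have [xy0|xy] := eqVneq (chi [:: x; y]) 0.
    by rewrite xy0 (supp0 x y) ?mulr0.
  rewrite -(pc2_ratio_const xy uv) -mulrA; rewrite supp in xy.
  by case: (pc_neq0P H' xy) => ->; rewrite ?mulrNN !mulr1.
have uv' := uv; rewrite supp in uv'; move: extend.
case: (pc_neq0P H uv) => ->; case: (pc_neq0P H' uv') => -> extend;
  [left|right|right|left] => t; by rewrite extend ?mulrNN ?mulr1 ?mul1r ?mulN1r.
Qed.

End Proportional.

Section RankTwoConverse.

Context {F : {set E}} {chi : seq (signed E) -> int} (H : chirotope_on F 2 chi).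
Local Notation c x y := (chi [:: x; y]).

Lemma cho2_ground x : star x \in F <-> exists y, c x y != 0.
Proof.
split=> [xF|[y xy]]; last first.
  by apply: (cho_sub_ground H xy); rewrite inE eqxx.
have [s xs] := cho_ground_cons H xF.
by case: s xs (pc_size H xs) => [|y []] // xy _; exists y.
Qed.

Definition codirectional x y : bool := [forall z, c x z == c y z].

Lemma codirP x y : reflect (forall z, c x z = c y z) (codirectional x y).
Proof. exact: 'forall_eqP. Qed.

Lemma codir_refl x : codirectional x x.
Proof. exact/codirP. Qed.

Lemma codir_sym x y : codirectional x y = codirectional y x.
Proof. by apply/codirP/codirP. Qed.

Lemma codir_trans y x z :
  codirectional x y -> codirectional y z -> codirectional x z.
Proof. by move=> /codirP xy /codirP yz; apply/codirP => u; rewrite xy. Qed.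

Lemma codir_bar x y : codirectional (bar x) y = codirectional x (bar y).
Proof.
apply/codirP/codirP => xy z; have := xy z; rewrite !(pc2_barl H).
  by move=> <-; rewrite opprK.
by move=> ->; rewrite opprK.
Qed.

Lemma codir_chi x x' y y' :
  codirectional x x' -> codirectional y y' -> c x y = c x' y'.
Proof.
move=> /codirP-> /codirP yy'.
by rewrite (pc2_swap H y) yy' (pc2_swap H x') opprK.
Qed.

Lemma codir_chi0 x y : codirectional x y -> c x y = 0.
Proof. by move/codirP->; exact: pc2_diag H _. Qed.

Lemma codir_ground x y : codirectional x y -> star x \in F -> star y \in F.
Proof.
move=> /codirP xy /cho2_ground[z xz].
by apply/cho2_ground; exists z; rewrite -xy.
Qed.

Lemma codir_barN x : star x \in F -> ~~ codirectional x (bar x).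
Proof.
case/cho2_ground=> z; apply: contra => /codirP/(_ z).
by rewrite (pc2_barl H) => /esym/eqP; rewrite eqNr.
Qed.

Lemma chi0_codir x y : star x \in F -> star y \in F -> c x y = 0 ->
  codirectional x y || codirectional x (bar y).
Proof.
move=> /cho2_ground[u xu] /cho2_ground[v yv] xy0.
have plucker z : c x z * c y v = c x v * c y z by exact: (pc2_plucker0 H).
have xv : c x v != 0.
  apply: contraNneq xu => xv0; have /eqP := plucker u.
  by rewrite xv0 mul0r mulf_eq0 (negPf yv) orbF.
have [exy|exy] : c x v = c y v \/ c x v = - c y v.
  by case: (pc_neq0P H xv) => ->; case: (pc_neq0P H yv) => ->;
    [left|right|right|left].
- apply/orP; left; apply/codirP => z; apply: (mulIf yv).
  by rewrite plucker exy mulrC.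
- apply/orP; right; apply/codirP => z; apply: (mulIf yv).
  by rewrite plucker exy (pc2_barl H) !mulNr mulrC.
Qed.

Section HalfPlane.

Context (x0 : signed E) (x0F : star x0 \in F).

Definition half_plane : pred (signed E) :=
  fun x => (star x \in F) && ((c x0 x == 1) || codirectional x0 x).

Lemma half_plane_or_bar x :
  star x \in F -> half_plane x || half_plane (bar x).
Proof.
move=> xF; rewrite /half_plane star_bar xF /= (pc2_barr H).
have [x0x|x0x|x0x] := pc_cases H [:: x0; x]; rewrite x0x.
- by rewrite opprK eqxx orbT.
- by case/orP: (chi0_codir x0F xF x0x) => ->; rewrite ?orbT.
- by rewrite eqxx.
Qed.

Lemma half_plane_codir x y : codirectional x y -> half_plane x -> half_plane y.
Proof.
move=> xy /andP[xF x_half]; rewrite /half_plane (codir_ground xy xF) /=.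
rewrite -(codir_chi (codir_refl x0) xy); case/orP: x_half => [-> //|x0x].
by rewrite (codir_trans x0x xy) orbT.
Qed.

Lemma half_plane_barN x : half_plane x -> ~~ half_plane (bar x).
Proof.
move=> /andP[xF x_half]; rewrite /half_plane star_bar xF /= (pc2_barr H).
have xbar := codir_barN xF.
apply/negP => /orP[] bx_half; case/orP: x_half => x_half.
- by move: bx_half; rewrite (eqP x_half).
- by move: bx_half; rewrite (codir_chi0 x_half) oppr0.
- by have := codir_chi0 bx_half; rewrite (pc2_barr H) (eqP x_half).
- by move/negP: xbar; apply; apply: codir_trans bx_half; rewrite codir_sym.
Qed.

Lemma half_plane_ge0 x : half_plane x -> 0 <= c x0 x.
Proof. by case/andP=> _ /orP[/eqP-> //|/codir_chi0 ->]. Qed.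

Lemma half_plane_chi0 x y :
  half_plane x -> half_plane y -> c x y = 0 -> codirectional x y.
Proof.
move=> hx hy xy0; case/andP: (hx) => xF _; case/andP: (hy) => yF _.
case/orP: (chi0_codir xF yF xy0) => // xby.
by have := half_plane_barN hy; rewrite (half_plane_codir xby hx).
Qed.

Definition counterclockwise x y : bool := 0 <= c x y.

Lemma counterclockwise_total : {in half_plane &, total counterclockwise}.
Proof.
move=> x y _ _; rewrite /counterclockwise (pc2_swap H x) oppr_ge0.
exact: le_total.
Qed.

Lemma counterclockwise_trans :
  {in half_plane & &, transitive counterclockwise}.
Proof.
move=> y x z hy hx hz; rewrite /counterclockwise => xy yz.
have [xy0|xyn0] := eqVneq (c x y) 0.
  by rewrite (codir_chi (half_plane_chi0 hx hy xy0) (codir_refl z)).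
have [yz0|yzn0] := eqVneq (c y z) 0.
  by rewrite -(codir_chi (codir_refl x) (half_plane_chi0 hy hz yz0)).
have : 0 <= c x z * c x0 y.
  apply: (pc2_C4 H); first by rewrite mulr_ge0 // half_plane_ge0.
  by rewrite (pc2_barr H) -(pc2_swap H) mulr_ge0 // half_plane_ge0.
case/andP: (hy) => yF /orP[/eqP->|/codirP x0y]; first by rewrite mulr1.
have := half_plane_ge0 hx; rewrite x0y (pc2_swap H x) oppr_ge0 => yx.
by case/eqP: xyn0; apply/eqP; rewrite eq_le yx xy.
Qed.

Definition direction x : signed E := odflt x [pick y | codirectional x y].

Lemma codir_direction x : codirectional x (direction x).
Proof.
by rewrite /direction; case: pickP => [//|/(_ x)]; rewrite codir_refl.
Qed.

Lemma direction_eq x y : codirectional x y -> direction x = direction y.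
Proof.
move=> xy; have same : codirectional x =1 codirectional y.
  move=> z; apply/idP/idP; apply: codir_trans => //.
  by rewrite codir_sym.
rewrite /direction (eq_pick same); case: pickP => // /(_ y).
by rewrite codir_refl.
Qed.

Definition half_directions : seq (signed E) :=
  sort counterclockwise
    [seq x <- enum {: signed E} | half_plane x && (direction x == x)].

Lemma mem_half_directions x :
  (x \in half_directions) = half_plane x && (direction x == x).
Proof. by rewrite mem_sort mem_filter mem_enum andbT. Qed.

Local Notation k := (size half_directions).
Local Notation dir i := (nth x0 half_directions i).

Lemma half_plane_dir i : (i < k)%N -> half_plane (dir i).
Proof. by move=> /(mem_nth x0); rewrite mem_half_directions => /andP[]. Qed.

Lemma codir_dir_inj i j : (i < k)%N -> (j < k)%N ->
  codirectional (dir i) (dir j) -> i = j.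
Proof.
have dirs_uniq : uniq half_directions.
  by rewrite sort_uniq filter_uniq // enum_uniq.
move=> ik jk /direction_eq; move: (mem_nth x0 ik) (mem_nth x0 jk).
rewrite !mem_half_directions => /andP[_ /eqP->] /andP[_ /eqP->] /eqP.
by rewrite nth_uniq // => /eqP.
Qed.

Lemma chi_dir i j : (i < j < k)%N -> c (dir i) (dir j) = 1.
Proof.
case/andP=> ij jk; have ik := ltn_trans ij jk.
have halves : all half_plane half_directions.
  by apply/(all_nthP x0) => l; exact: half_plane_dir.
have dirs_sorted : sorted counterclockwise half_directions.
  apply: (sort_sorted_in counterclockwise_total).
  by apply/allP => x; rewrite mem_filter => /andP[/andP[]].
have ccw : 0 <= c (dir i) (dir j).
  exact: (sorted_ltn_nth_in counterclockwise_trans) ik jk ij.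
have nz : c (dir i) (dir j) != 0.
  have [hi hj] := (half_plane_dir ik, half_plane_dir jk).
  apply: contraTneq ij => /(half_plane_chi0 hi hj)/(codir_dir_inj ik jk)->.
  by rewrite ltnn.
by case: (pc_neq0P H nz) ccw => // ->.
Qed.

Definition ray i : signed E := if (i < k)%N then dir i else bar (dir (i - k)).

Lemma chi_ray i j : (i < k.*2)%N -> (j < k.*2)%N ->
  c (ray i) (ray j) = precedes_sign k i j.
Proof.
have chi_nth i' j' : (i' < k)%N -> (j' < k)%N ->
    c (dir i') (dir j') =
    if (i' < j')%N then 1 else if (j' < i')%N then -1 else 0.
  move=> li lj; case: ltngtP => ij.
  - by rewrite chi_dir // ij.
  - by rewrite (pc2_swap H) chi_dir // ij.
  - by rewrite ij; exact: pc2_diag H _.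
move=> li lj; rewrite /ray /precedes_sign /precedes.
case: ifP => ik; case: ifP => jk;
  rewrite ?(pc2_barr H) ?(pc2_barl H) chi_nth; try lia.
all: by do !case: ifP; lia.
Qed.

Lemma ray_ground i : (i < k.*2)%N -> star (ray i) \in F.
Proof.
have dir_ground j : (j < k)%N -> star (dir j) \in F.
  by move=> /half_plane_dir/andP[].
move=> li; rewrite /ray; case: ifP => ik; first exact: dir_ground.
by rewrite star_bar dir_ground //; lia.
Qed.

Lemma ray_ex x :
  star x \in F -> exists2 i, (i < k.*2)%N & codirectional (ray i) x.
Proof.
have dir_ex y : half_plane y -> exists2 i, (i < k)%N & codirectional (dir i) y.
  move=> hy; have dy : direction y \in half_directions.
    rewrite mem_half_directions (half_plane_codir (codir_direction y) hy) /=.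
    by apply/eqP/esym/direction_eq/codir_direction.
  exists (index (direction y) half_directions); first by rewrite index_mem.
  by rewrite nth_index // codir_sym codir_direction.
move=> xF; case/orP: (half_plane_or_bar xF) => /dir_ex[i ik codir_i].
  by exists i; [lia|rewrite /ray ik].
exists (i + k)%N; first by lia.
by rewrite /ray ifN ?addnK ?codir_bar // -leqNgt leq_addl.
Qed.

Lemma ray_antipode i : (i < k.*2)%N -> ray (antipode k i) = bar (ray i).
Proof.
rewrite /ray /antipode => li; case: (ltnP i k) => ik.
  by rewrite ifN ?addnK // -leqNgt leq_addl.
by rewrite ifT ?barK //; lia.
Qed.

Lemma codir_ray_inj i j : (i < k.*2)%N -> (j < k.*2)%N ->
  codirectional (ray i) (ray j) -> i = j.
Proof.
move=> li lj codir_ij; have := codir_chi0 codir_ij; rewrite chi_ray //.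
rewrite /precedes_sign.
case/or4P: (precedes_total li lj) => [/eqP //|/eqP ej|->|ji] //.
  move: codir_ij; rewrite ej ray_antipode //.
  by rewrite (negPf (codir_barN (ray_ground li))).
by rewrite ji; case: ifP.
Qed.

Definition hseq2_of_chi : hseq2 E := @Hseq2 E k
  [ffun a : 'Z_(k.*2) => [set y | codirectional (ray (val a)) y]].

Lemma mem_hseq2_of_chi x a :
  (x \in atom hseq2_of_chi a) = codirectional (ray (val a)) x.
Proof. by rewrite ffunE inE. Qed.

Lemma size_half_directions_gt1 : (1 < k)%N.
Proof.
have [z x0z] := (cho2_ground x0).1 x0F.
have zF : star z \in F.
  by apply/cho2_ground; exists x0; rewrite (pc2_swap H) oppr_eq0.
have [i li codir_i] := ray_ex x0F; have [j lj codir_j] := ray_ex zF.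
move: x0z; rewrite -(codir_chi codir_i codir_j) chi_ray //.
by rewrite /precedes_sign /precedes; do !case: ifP; lia.
Qed.

Lemma is_hseq2_of_chi : is_hseq2 F hseq2_of_chi.
Proof.
have k1 := size_half_directions_gt1; have gt1 : (1 < k.*2)%N by lia.
have ltZ (a : 'Z_(k.*2)) := Zp_ltn gt1 a.
split=> //.
- move=> a; split=> //.
    by apply/set0Pn; exists (ray (val a)); rewrite mem_hseq2_of_chi codir_refl.
  rewrite /starset card_in_imset // => x y; rewrite !mem_hseq2_of_chi => ax ay.
  case/star_eqP => // exy; rewrite exy in ax.
  have yF := codir_ground ay (ray_ground (ltZ a)).
  have /negP[] := codir_barN yF.
  by apply: codir_trans ax; rewrite codir_sym.
- move=> a; apply/setP => x; rewrite mem_barset !mem_hseq2_of_chi.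
  by rewrite Zp_val_half ?(ltnW k1) // ray_antipode ?codir_bar //; exact: ltZ.
- apply/setP => x; rewrite inE; apply/bigcupP/idP => [[a _]|xF].
    by rewrite mem_hseq2_of_chi => /codir_ground; apply; exact: ray_ground.
  have [i li codir_i] := ray_ex xF; exists (i%:R) => //.
  by rewrite mem_hseq2_of_chi Zp_val_nat.
- move=> a b ab; apply/pred0P => x /=; apply/negP => /andP[].
  rewrite !mem_hseq2_of_chi => ax; rewrite codir_sym => bx.
  case/eqP: ab; apply: val_inj.
  by apply: codir_ray_inj (codir_trans ax bx); exact: ltZ.
Qed.

Lemma realizes_hseq2_of_chi : realizes (hseq2_posbase hseq2_of_chi) chi.
Proof.
move=> t; have hZ := is_hseq2_of_chi; have lt_pos := position_lt hZ.
have codir_pos x : star x \in F ->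
    codirectional (ray (position hseq2_of_chi x)) x.
  case/(atom_ex hZ)=> a /[dup] xa /(position_atom hZ)->.
  by rewrite -mem_hseq2_of_chi.
have chiE x y : star x \in F -> star y \in F -> c x y =
    precedes_sign k (position hseq2_of_chi x) (position hseq2_of_chi y).
  move=> /codir_pos xF /codir_pos yF; rewrite -(codir_chi xF yF).
  exact: chi_ray (lt_pos x) (lt_pos y).
split=> [/[dup] Zt /hseq2_posbase_size|t1].
  case: t Zt => [|x [|y []]] // /(hseq2_posbaseP hZ)[xF yF prec] _.
  by rewrite chiE // /precedes_sign ifT.
have nz : chi t != 0 by rewrite t1.
case: t t1 nz (pc_size H nz) => [|x [|y []]] // xy1 nz _.
have xF : star x \in F by apply: (cho_sub_ground H nz); rewrite inE eqxx.
have yF : star y \in F by apply: (cho_sub_ground H nz); rewrite !inE eqxx orbT.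
apply/(hseq2_posbaseP hZ); split=> //.
move: xy1; rewrite chiE // /precedes_sign.
by case: ifP => //; case: ifP.
Qed.

End HalfPlane.

End RankTwoConverse.

Lemma chirotope2_hseq2 (F : {set E}) chi : F != set0 -> chirotope_on F 2 chi ->
  exists2 Z : hseq2 E, is_hseq2 F Z & realizes (hseq2_posbase Z) chi.
Proof.
case/set0Pn => e eF H; exists (hseq2_of_chi (F := F) (chi := chi) (inl e)).
  exact: is_hseq2_of_chi.
exact: realizes_hseq2_of_chi.
Qed.

End Rank2Chirotopes.

(** * Flats of codimension 2 *)

Lemma perm_cons_missing (T : eqType) (s t : seq T) :
  uniq s -> uniq t -> {subset t <= s} -> size s = (size t).+1 ->
  exists2 x, x \in s & perm_eq s (x :: t).
Proof.
move=> us ut ts size_s.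
have /hasP[x xs xt] : has [predC t] s.
  apply: contraT => /hasPn st; have := uniq_leq_size us (s2 := t).
  by rewrite size_s ltnn; apply=> x /st /negbNE.
exists x => //; rewrite perm_sym; apply: uniq_perm => //=.
  by rewrite ut andbT.
have [] := @uniq_min_size _ (x :: t) s => //=.
- by rewrite ut andbT.
- by move=> y; rewrite inE => /orP[/eqP->|/ts].
- by rewrite size_s.
Qed.

Section Flats.

Context {E : finType} {F : {set E}} {n : nat} {chi : seq (signed E) -> int}.
Context (H : chirotope_on F n.+2 chi).
Implicit Types (x y z u v : signed E) (b s t p : seq (signed E)).

Definition independent b : Prop := exists z1 z2, chi (b ++ [:: z1; z2]) != 0.

(* The flat spanned by b, when b is independent. *)
Definition flat b : {set E} :=
  [set e in F | [forall z, chi (b ++ [:: inl e; z]) == 0]].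

Definition base_of_flat (L : {set E}) b : Prop := independent b /\ flat b = L.

Lemma flatP b x : reflect (star x \in F /\ forall z, chi (b ++ [:: x; z]) = 0)
  (star x \in flat b).
Proof.
have starE z :
    (chi (b ++ [:: inl (star x); z]) == 0) = (chi (b ++ [:: x; z]) == 0).
  by case: x => // e; rewrite -[inr e]/(bar (inl e)) (alt_bar H) oppr_eq0.
rewrite inE; apply: (iffP andP) => -[xF bx0]; split=> //.
  by move=> z; apply/eqP; rewrite -starE; exact: forallP bx0 z.
by apply/forallP => z; rewrite starE bx0.
Qed.

Lemma chi_swap_neq0 p x y :
  (chi (p ++ [:: y; x]) != 0) = (chi (p ++ [:: x; y]) != 0).
Proof. by rewrite (alt_swap H) oppr_eq0. Qed.

Lemma notin_flat b x y : chi (b ++ [:: x; y]) != 0 ->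
  star x \notin flat b /\ star y \notin flat b.
Proof.
have notin_l u v : chi (b ++ [:: u; v]) != 0 -> star u \notin flat b.
  by apply: contra => /flatP[_ ->].
move=> bxy; split; first exact: notin_l bxy.
by apply: (notin_l y x); rewrite chi_swap_neq0.
Qed.

Lemma size_independent b : independent b -> size b = n.
Proof. by case=> z1 [z2 /(pc_size H)]; rewrite size_cat addn2 => -[]. Qed.

Lemma uniq_independent b : independent b -> uniq (map star b).
Proof. by case=> ? [? /(alt_uniq H)]; rewrite map_cat cat_uniq => /and3P[]. Qed.

Lemma sub_flat b : independent b -> {subset map star b <= flat b}.
Proof.
move=> [z1 [z2 nz]] e /mapP[x xb ->]; apply/flatP; split.
  by apply: (cho_sub_ground H nz); rewrite map_cat mem_cat map_f.
move=> z; apply: contraTeq isT => /(alt_neq0_disjoint H)/(_ (map_f star xb)).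
by rewrite inE eqxx.
Qed.

Lemma flat_neq0 b : (0 < n)%N -> independent b -> flat b != set0.
Proof.
move=> n0 ind_b; have := sub_flat ind_b; have := size_independent ind_b.
case: b {ind_b} => [sb|x b _ sub]; first by rewrite -sb in n0.
by apply/set0Pn; exists (star x); apply: sub; rewrite inE eqxx.
Qed.

Lemma setD_flat_neq0 b : independent b -> F :\: flat b != set0.
Proof.
case=> z1 [z2 nz]; apply/set0Pn; exists (star z1).
rewrite in_setD (notin_flat nz).1; apply: (cho_sub_ground H nz).
by rewrite map_cat mem_cat inE eqxx orbT.
Qed.

Lemma independent_pos b :
  independent b -> exists z1 z2, chi (b ++ [:: z1; z2]) = 1.
Proof.
move=> [z1 [z2 /(pc_neq0P H)[bz|bz]]]; first by exists z1, z2.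
exists z1, (bar z2); have := alt_bar H (b ++ [:: z1]) z2 [::].
by rewrite -!catA /= bz opprK.
Qed.

Lemma independent_extend b t : independent b -> chi t != 0 ->
  exists f g, [/\ f \in t, g \in t & chi (b ++ [:: f; g]) != 0].
Proof.
move=> ind_b nz; have [z1 [z2 /(extend_to_base H)/(_ nz)[t' bt' sub]]] := ind_b.
have := pc_size H bt'; rewrite size_cat (size_independent ind_b) -addn2.
move/addnI; case: t' bt' sub => [|f [|g []]] // bt' sub _; exists f, g.
by split=> //; apply: sub; rewrite !inE eqxx ?orbT.
Qed.

Lemma chi_neq0_span b s x y : independent b -> {subset map star s <= flat b} ->
  chi (s ++ [:: x; y]) != 0 -> chi (b ++ [:: x; y]) != 0.
Proof.
move=> ind_b sb /(independent_extend ind_b)[f [g [fs gs bfg]]].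
have [f_out g_out] := notin_flat bfg.
have tail z : z \in s ++ [:: x; y] -> star z \notin flat b -> z \in [:: x; y].
  by rewrite mem_cat => /orP[/(map_f star)/sb->|].
have := tail _ fs f_out; have := tail _ gs g_out; rewrite !inE.
have := alt_uniq H bfg.
rewrite map_cat cat_uniq /= inE => /and3P[_ _ /andP[fg _]].
case/orP=> /eqP eg; case/orP=> /eqP ef; subst f g; rewrite ?eqxx // in fg *.
by rewrite chi_swap_neq0.
Qed.

Lemma sub_flat_span b s : independent b -> {subset map star s <= flat b} ->
  {subset flat b <= flat s}.
Proof.
move=> ind_b sb e; rewrite -[e]/(star (inl e)) => /flatP[eF be0].
apply/flatP; split=> // z; apply/eqP.
by apply: contraT => /(chi_neq0_span ind_b sb); rewrite be0 eqxx.
Qed.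

Lemma chi_neq0_flat b s x y : independent b -> independent s ->
  {subset map star s <= flat b} ->
  (chi (s ++ [:: x; y]) != 0) = (chi (b ++ [:: x; y]) != 0).
Proof.
move=> ind_b ind_s sb; apply/idP/idP; first exact: chi_neq0_span.
apply: chi_neq0_span => // e /(sub_flat ind_b); exact: sub_flat_span.
Qed.

Lemma flat_eq b s : independent b -> independent s ->
  {subset map star s <= flat b} -> flat s = flat b.
Proof.
move=> ind_b ind_s sb; apply/setP => e; rewrite !inE; congr (_ && _).
by apply: eq_forallb => z; apply: negb_inj; exact: chi_neq0_flat.
Qed.

Lemma base_of_flat_sign_eq L s t : sign_eq chi s t -> base_of_flat L s ->
  base_of_flat L t.
Proof.
move=> st [[z1 [z2 nz]] <-]; split.
  by exists z1, z2; rewrite -(sign_eq_neq0 _ st).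
apply/setP => e; rewrite !inE; congr (_ && _); apply: eq_forallb => z.
by apply: negb_inj; rewrite (sign_eq_neq0 _ st).
Qed.

Lemma chi_flat0 b p x y z : independent b ->
  {subset map star (rcons p x) <= flat b} -> star y \in flat b ->
  chi (p ++ [:: x; y; z]) = 0.
Proof.
move=> ind_b px_flat y_flat; rewrite -cat_rcons.
apply/eqP; apply: contraT => nz.
by have /notin_flat[/negP[]] := chi_neq0_span ind_b px_flat nz.
Qed.

Lemma independent_prechirotope b :
  independent b -> prechirotope 2 (contraction chi b).
Proof.
move=> ind_b; apply: prechirotope_contraction.
by rewrite (size_independent ind_b) addn2; exact: H.
Qed.

(* Replacing one element of a base of a flat rescales the contraction by a
   sign: in the three-term relation that compares the two contractions, the
   third term vanishes. *)
Lemma sign_eq_exchange b p x x' : independent b ->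
  independent (rcons p x) -> independent (rcons p x') ->
  {subset map star (rcons p x) <= flat b} ->
  {subset map star (rcons p x') <= flat b} ->
  sign_eq chi (rcons p x) (rcons p x').
Proof.
move=> ind_b ind_x ind_x' px_flat px'_flat.
have Hx := independent_prechirotope ind_x.
have Hx' := independent_prechirotope ind_x'.
apply: (pc2_proportional Hx Hx').
  by move=> y z; rewrite /contraction !(chi_neq0_flat _ _ ind_b).
move=> z y y'; have Hz : prechirotope 2 (contraction chi (rcons p z)).
  apply: prechirotope_contraction.
  rewrite size_rcons -(size_rcons p x) (size_independent ind_x) addn2.
  exact: H.
have := pc2_plucker0 Hz (a := x) (a' := x') y y'.
rewrite /contraction !cat_rcons !(alt_swap H p _ z) !mulrNN; apply.
rewrite -[[:: x, z & _]]/([:: x] ++ [:: z; x']) catA (alt_swap H) -catA /=.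
rewrite (chi_flat0 _ ind_b px_flat) ?oppr0 //.
by apply: px'_flat; rewrite map_rcons mem_rcons inE eqxx.
Qed.

Lemma sign_eq_sub_star b s : independent b -> independent s ->
  {subset map star s <= map star b} -> sign_eq chi s b.
Proof.
move=> ind_b ind_s sb; apply: (sign_eq_perm_star H).
have us := uniq_independent ind_s; apply: uniq_perm => //.
  exact: uniq_independent.
have [] // := uniq_min_size us sb.
by rewrite !size_map !size_independent.
Qed.

Lemma flat_exchange b p x : independent b -> independent (rcons p x) ->
  {subset map star (rcons p x) <= flat b} ->
  exists2 y, y \in b & independent (rcons p y).
Proof.
move=> ind_b [z1 [z2 px]] px_flat; have bz := chi_neq0_span ind_b px_flat px.
rewrite (alt_move2 H) cats0 in px.
have [y + py] := pc_C3 H (s := [:: z1, z2 & p]) px bz.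
rewrite mem_cat => /orP[yb|yz].
  by exists y => //; exists z1, z2; rewrite (alt_move2 H) cats0.
have := alt_neq0_disjoint H (s := [:: z1; z2]) py (map_f star yz).
by rewrite map_rcons mem_rcons inE eqxx.
Qed.

Lemma flat_sign_eq b s : independent b -> independent s ->
  {subset map star s <= flat b} -> sign_eq chi s b.
Proof.
move=> ind_b; have [m] := ubnP (count (fun x => star x \notin map star b) s).
elim: m s => // m IH s count_s ind_s sb.
have [/hasP[x xs xb]|/hasPn s_b] :=
    boolP (has (fun x => star x \notin map star b) s); last first.
  apply: sign_eq_sub_star => // _ /mapP[y /s_b + ->].
  by rewrite negbK.
pose p := rem x s.
have perm_s : perm_eq s (rcons p x).
  by rewrite perm_sym perm_rcons perm_sym perm_to_rem.
have sx : sign_eq chi s (rcons p x).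
  by apply: (sign_eq_perm_star H); exact: perm_map.
have ind_px : independent (rcons p x).
  by case: ind_s => z1 [z2]; rewrite (sign_eq_neq0 _ sx); exists z1, z2.
have px_flat : {subset map star (rcons p x) <= flat b}.
  by move=> e; rewrite -(perm_mem (perm_map star perm_s)); exact: sb.
have [y yb ind_py] := flat_exchange ind_b ind_px px_flat.
have y_flat : star y \in flat b by apply: (sub_flat ind_b); exact: map_f.
have py_flat : {subset map star (rcons p y) <= flat b}.
  move=> e; rewrite map_rcons mem_rcons inE => /orP[/eqP->//|ep].
  by apply: px_flat; rewrite map_rcons mem_rcons inE ep orbT.
apply: (sign_eq_trans sx).
apply: (sign_eq_trans (sign_eq_exchange ind_b ind_px ind_py px_flat py_flat)).
apply: IH => //; move: count_s.
rewrite (permP perm_s) -!cats1 !count_cat /= xb (map_f star yb) /=; lia.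
Qed.

Lemma chirotope_contraction_flat b : independent b ->
  chirotope_on (F :\: flat b) 2 (contraction chi b).
Proof.
move=> ind_b; split; first exact: independent_prechirotope.
move=> e; rewrite in_setD; split=> [/andP[+ eF]|[t bt et]].
  rewrite inE eF /= => /forallPn[z nz].
  by exists [:: inl e; z]; rewrite ?inE ?eqxx.
rewrite (cho_sub_ground H bt) ?map_cat ?mem_cat ?et ?orbT // andbT.
have t2 := pc_size (independent_prechirotope ind_b) bt.
case: t bt et t2 => [|x [|y []]] // /notin_flat[x_out y_out] + _.
by rewrite /= in_cons mem_seq1 => /orP[]/eqP->.
Qed.

Lemma flat_base_through b z1 z2 x : chi (b ++ [:: z1; z2]) != 0 ->
  star x \in flat b ->
  exists2 y, y \in b & chi (x :: rem y b ++ [:: z1; z2]) != 0.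
Proof.
move=> bz /flatP[xF bx0]; have [p xp] := cho_ground_cons H xF.
have [q xq qb] := extend_to_base H (s := [:: x]) xp bz.
have size_bz : size (b ++ [:: z1; z2]) = (size q).+1.
  by rewrite (pc_size H bz) -(pc_size H xq).
have uniq_q : uniq q by have /andP[_ /map_uniq] := alt_uniq H xq.
have [y] := perm_cons_missing (map_uniq (alt_uniq H bz)) uniq_q qb size_bz.
have not_missing z z' : perm_eq (b ++ [:: z; z']) (z :: q) -> False.
  rewrite (perm_catCA b [:: z]) perm_cons => perm_q.
  have : chi (b ++ [:: x; z']) != 0.
    apply: (alt_neq0_perm H) xq.
    by rewrite perm_sym (perm_catCA b [:: x]) perm_cat2l.
  by rewrite bx0 eqxx.
rewrite mem_cat !inE => /or3P[yb|/eqP->|/eqP->] perm_bz.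
- exists y => //; apply: (alt_neq0_perm H) xq; rewrite /= perm_cons.
  rewrite -(perm_cons y) perm_sym (perm_trans _ perm_bz) //.
  by rewrite -cat_cons perm_cat2r perm_sym perm_to_rem.
- by case: (not_missing _ _ perm_bz).
case: (not_missing z2 z1); apply: perm_trans perm_bz.
by rewrite perm_cat2l (perm_catC [:: z2]).
Qed.

Lemma chirotope_restriction_flat b z1 z2 : chi (b ++ [:: z1; z2]) != 0 ->
  chirotope_on (flat b) n (restriction (flat b) (contraction chi [:: z1; z2])).
Proof.
move=> bz; have ind_b : independent b by exists z1, z2.
split.
  apply/prechirotope_restriction/prechirotope_contraction.
  by rewrite add2n; exact: H.
move=> e; split=> [e_flat|[s /restriction_neq0[sub _] /sub //]].
rewrite -[e]/(star (inl e)) in e_flat *.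
have [y yb nz] := flat_base_through bz e_flat.
exists (inl e :: rem y b); last by rewrite inE eqxx.
rewrite restrictionE.
  by rewrite /contraction -[_ ++ _]cats0 -(alt_move2 H).
move=> f; rewrite inE => /orP[/eqP-> //|/mapP[u /mem_rem ub ->]].
by apply: (sub_flat ind_b); exact: map_f.
Qed.

End Flats.

Arguments independent {E} chi b.
Arguments flat {E} F chi b.
Arguments base_of_flat {E} F chi L b.

(** * All ranks: from chirotopes to hyperline sequences *)

Section Converse.

Context {E : finType}.
Implicit Types (F L : {set E}) (s t b : seq (signed E)).
Implicit Types chi : seq (signed E) -> int.

Definition represents_chirotopes (n : nat) (D : rank_data E) : Prop :=
  forall F chi, F != set0 -> chirotope_on F n chi ->
    exists2 X : rd_type D, rd_is_hseq F X & realizes (rd_posbase X) chi.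

Lemma rank1_represents : represents_chirotopes 1 (rank1 E).
Proof.
move=> F chi /set0Pn[e0 e0F] H.
have chi_bar x : chi [:: bar x] = - chi [:: x] by exact: (alt_bar H [::]).
have chi_neq0 e : e \in F -> chi [:: inl e] != 0.
  move=> /(cho_ground_cons (x := inl e) H)[s nz].
  by case: s nz (pc_size H nz).
pose X := [set x | chi [:: x] == 1].
have starX : starset X = F.
  apply/setP => e; rewrite -[e]/(star (inl e)) mem_starset_star !inE chi_bar.
  apply/idP/idP => [|/chi_neq0/(pc_neq0P H)[]->]; rewrite ?opprK ?eqxx ?orbT //.
  rewrite eqr_oppLR => e_pos; apply: (cho_sub_ground H (s := [:: inl e])).
    by case/orP: e_pos => /eqP->.
  by rewrite inE eqxx.
exists X; first split=> //.
- by move: e0F; rewrite -starX => /imsetP[x xX _]; apply/set0Pn; exists x.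
- rewrite /starset card_in_imset // => x y; rewrite !inE => /eqP x1 /eqP y1.
  by case/star_eqP => // exy; move: x1; rewrite exy chi_bar y1.
move=> s; split=> [[x + ->]|s1]; first by rewrite inE => /eqP.
have nz : chi s != 0 by rewrite s1.
case: s s1 nz (pc_size H nz) => [|x []] // x1 _ _.
by exists x; rewrite // inE x1.
Qed.

Section RankUp.

Context {F : {set E}} {n : nat} {chi : seq (signed E) -> int}.
Context (H : chirotope_on F n.+2 chi) (n_gt0 : (0 < n)%N).
Context {D : rank_data E} (RL : rank_laws n D).
Implicit Types (Y : rd_type D) (Z : hseq2 E).
Local Notation base_of_flat := (base_of_flat F chi).
Local Notation flat := (flat F chi).

Definition is_flat L : Prop := exists b, base_of_flat L b.

(* (Y|Z) is, up to sign, the hyperline that chi induces on the flat L: Y orients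
   the bases of L, and Z the contraction by any base positive in Y. *)
Definition hyperline L Y Z : Prop :=
  [/\ rd_is_hseq L Y, is_hseq2 (F :\: L) Z,
      forall s, rd_posbase Y s -> base_of_flat L s /\
        realizes (hseq2_posbase Z) (contraction chi s)
    & forall s, base_of_flat L s ->
        rd_posbase Y s \/ rd_posbase Y (simplex_opp s)].

Lemma base_of_flat_opp L s : base_of_flat L (simplex_opp s) -> base_of_flat L s.
Proof.
apply: (base_of_flat_sign_eq (L := L)).
by apply: (sign_eq_perm_star H); rewrite map_star_opp.
Qed.

Lemma hyperline_opp L Y Z :
  hyperline L Y Z -> hyperline L (rd_opp Y) (hseq2_opp Z).
Proof.
case=> hY hZ Ybase baseY; split.
- exact: rl_is_hseq_opp RL _ _ hY.
- exact: is_hseq2_opp.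
- move=> s /(rl_posbase_opp RL) /[dup] Ys /Ybase[bs Zs]; split=> [|t].
    exact: base_of_flat_opp.
  have s0 : s != [::].
    apply: contraTneq n_gt0 => es.
    by rewrite -(ob_size (rl_oriented_bases RL hY) Ys) es.
  rewrite hseq2_posbase_opp Zs (pc_opp (independent_prechirotope H bs.1)) //.
  by rewrite /contraction (alt_opp_cat H) // opprK.
- move=> s /baseY[] Ys; [right|left]; apply/(rl_posbase_opp RL) => //.
  by rewrite simplex_oppK.
Qed.

Lemma hyperline_ex L : represents_chirotopes n D -> is_flat L ->
  exists Y Z, hyperline L Y Z.
Proof.
move=> rep [b [ind_b <-]]; have [z1 [z2 bz]] := independent_pos H ind_b.
have bz_neq0 : chi (b ++ [:: z1; z2]) != 0 by rewrite bz.
have restrE s : {subset map star s <= flat b} ->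
    restriction (flat b) (contraction chi [:: z1; z2]) s =
    chi (s ++ [:: z1; z2]).
  by move=> sub; rewrite restrictionE // (alt_move2 H) cats0.
have HY := chirotope_restriction_flat H bz_neq0.
have [Y hY Ys] := rep _ _ (flat_neq0 H n_gt0 ind_b) HY.
have HZ := chirotope_contraction_flat H ind_b.
have [Z hZ Zt] := chirotope2_hseq2 (setD_flat_neq0 H ind_b) HZ.
exists Y, Z; split=> // s.
  move=> /Ys /[dup] s1; rewrite /restriction; case: ifP => // /allP sub _.
  rewrite restrE // in s1; have ind_s : independent chi s.
    by exists z1, z2; rewrite s1.
  split; first by split=> //; exact: (flat_eq H).
  move=> t; rewrite Zt; case: (flat_sign_eq H ind_b ind_s sub) => sb.
    by rewrite /contraction sb.
  by move: s1; rewrite sb bz.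
case=> ind_s eL; have sub : {subset map star s <= flat b}.
  by rewrite -eL; exact: (sub_flat H).
case: (flat_sign_eq H ind_b ind_s sub) => sb; [left|right]; apply/Ys.
  by rewrite restrE // sb.
by rewrite (pc_opp HY) // restrE // sb bz opprK.
Qed.

Lemma chi_neq0_prefix s : chi s != 0 -> exists u z1 z2,
  [/\ s = u ++ [:: z1; z2], size u = n & base_of_flat (flat u) u].
Proof.
move=> nz; have size_s := pc_size H nz.
have [u [z1 [z2 def_s]]] := size_cat_pair size_s; exists u, z1, z2.
split=> //; first by move: size_s; rewrite def_s size_cat addn2 => -[].
by split=> //; exists z1, z2; rewrite -def_s.
Qed.

Lemma is_flat_ex : F != set0 -> exists L, is_flat L.
Proof.
case/set0Pn=> e /(cho_ground H)[s /chi_neq0_prefix[u [_ [_ [_ _ bu]]]] _].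
by exists (flat u), u.
Qed.

Section Lines.

Context (line : {set E} -> rd_type D * hseq2 E).
Context (lineP : forall L, is_flat L -> hyperline L (line L).1 (line L).2).

Definition signed_line L Y Z : Prop :=
  (Y = (line L).1 /\ Z = (line L).2) \/
  (Y = rd_opp (line L).1 /\ Z = hseq2_opp (line L).2).

Definition lines : hyperlines D :=
  fun Y Z => exists2 L, is_flat L & signed_line L Y Z.

Lemma signed_lineP L Y Z : is_flat L -> signed_line L Y Z -> hyperline L Y Z.
Proof.
by move=> /lineP hypL [] [-> ->] //; exact: hyperline_opp.
Qed.

Lemma signed_line_eq L Y1 Z1 Y2 Z2 :
  signed_line L Y1 Z1 -> signed_line L Y2 Z2 ->
  (rd_eq Y1 Y2 /\ hseq2_eq Z1 Z2) \/
  (rd_eq Y1 (rd_opp Y2) /\ hseq2_eq Z1 (hseq2_opp Z2)).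
Proof.
have eqY := rl_eq_refl RL; have eqYoppK := rl_eq_oppK RL.
have eqZ := @hseq2_eq_refl E; have eqZoppK := @hseq2_eq_oppK E.
by case=> -[-> ->] [] [-> ->]; [left|right|right|left].
Qed.

Lemma realizes_lines : realizes (hyperlines_posbase n lines) chi.
Proof.
move=> s; split=> [[_ [Y [Z [[L flatL YZ] Ys Zs]]]]|s1].
  have [_ _ Ybase _] := signed_lineP flatL YZ.
  have [_ /(_ (drop n s))] := Ybase _ Ys.
  by rewrite /contraction cat_take_drop => <-.
have nz : chi s != 0 by rewrite s1.
split; first by rewrite /oriented (pc_size H nz) eqxx (alt_uniq H nz).
have [u [z1 [z2 [def_s size_u bu]]]] := chi_neq0_prefix nz.
rewrite def_s take_size_cat // drop_size_cat //.
have flatL : is_flat (flat u) by exists u.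
suff [Y [Z [YZ Yu]]] : exists Y Z, signed_line (flat u) Y Z /\ rd_posbase Y u.
  have [_ _ Ybase _] := signed_lineP flatL YZ.
  exists Y, Z; split=> //; first by exists (flat u).
  by apply/(Ybase _ Yu).2; rewrite /contraction -def_s.
have [_ _ _ /(_ u bu)[Yu|Yu]] := lineP flatL; rewrite /signed_line.
  by exists (line (flat u)).1, (line (flat u)).2; split=> //; left.
exists (rd_opp (line (flat u)).1), (hseq2_opp (line (flat u)).2).
by split; [right|apply/(rl_posbase_opp RL)].
Qed.

Lemma is_hyperlines_lines : F != set0 -> is_hyperlines n F lines.
Proof.
move=> F0; split.
- have [L flatL] := is_flat_ex F0.
  by exists (line L).1, (line L).2, L; last left.
- move=> Y Z [L flatL /(signed_lineP flatL)[hY hZ _ _]].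
  exists L, (F :\: L); split=> //; last first.
    by apply/pred0P => f /=; rewrite in_setD; case: (f \in L).
  apply/setP => f; rewrite in_setU in_setD.
  have [fL|//] := boolP (f \in L); case: flatL => b [_ eL].
  by move: fL; rewrite -eL inE => /andP[].
- move=> Y1 Z1 Y2 Z2 FY2 s [L1 flatL1 YZ1] [L2 flatL2 YZ2] Y1s hY2 sub.
  suff eL : L1 = L2 by apply: signed_line_eq YZ1 _; rewrite eL.
  have [_ _ Y1base _] := signed_lineP flatL1 YZ1.
  have [hY2' _ _ _] := signed_lineP flatL2 YZ2.
  have [[ind_s <-] _] := Y1base _ Y1s; case: flatL2 => b [ind_b eL2].
  rewrite -eL2; apply: (flat_eq H) => //.
  have BY := rl_oriented_bases RL; rewrite eL2.
  by rewrite -(ob_ground_uniq (BY _ _ hY2) (BY _ _ hY2')).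
- move=> s x t /realizes_lines sx /realizes_lines t1.
  have [||y yt sy] := pc_C3 H (s := s) (x := x) (t := t); rewrite ?sx ?t1 //.
  exists y => //; rewrite !realizes_lines -!cats1 (alt_bar H) cats1.
  by case: (pc_neq0P H sy) => ->; [left|right; rewrite opprK].
- by move=> p x y z; rewrite !realizes_lines (alt_bar H) -(alt_swap H).
Qed.

End Lines.

End RankUp.

Arguments is_flat F chi L : clear implicits.
Arguments hyperline F chi {D} L Y Z.
Arguments lines F chi {D} line Y Z.

Lemma rank_up_represents n D : (0 < n)%N -> rank_laws n D ->
  represents_chirotopes n D -> represents_chirotopes n.+2 (rank_up n D).
Proof.
move=> n0 RL rep F chi F0 H.
have [L0 /(hyperline_ex H n0 rep)[Y0 [Z0 _]]] := is_flat_ex H F0.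
have /choice[line lineP] : forall L, exists YZ : rd_type D * hseq2 E,
    is_flat F chi L -> hyperline F chi L YZ.1 YZ.2.
  move=> L; have [flatL|] := pselect (is_flat F chi L).
    by have [Y [Z hyp]] := hyperline_ex H n0 rep flatL; exists (Y, Z).
  by exists (Y0, Z0).
exists (lines F chi line); first exact: (is_hyperlines_lines H n0 RL).
exact: (realizes_lines H n0 RL).
Qed.

Theorem rank_datum_represents r :
  (0 < r)%N -> represents_chirotopes r (rank_datum E r).
Proof.
elim/ltn_ind: r => -[|[|[|q]]] IH // _.
- exact: rank1_represents.
- by move=> F chi; exact: chirotope2_hseq2.
- by apply: rank_up_represents; [|exact: rank_laws_datum|exact: IH].
Qed.

End Converse.

Theorem theorem3p1 (disp : Order.disp_t) (E : finOrderType disp) (r : nat)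
    (r_ge1 : (1 <= r)%N) :
  (forall X : hseq E r, is_hseq [set: E] X ->
     exists chi : seq (signed E) -> int, chirotope r chi /\
       (forall s : seq (signed E), hseq_posbase X s <-> chi_posbase chi s))
  /\
  ((0 < #|E|)%N ->
   forall chi : seq (signed E) -> int, chirotope r chi ->
     exists X : hseq E r, is_hseq [set: E] X /\
       (forall s : seq (signed E), chi_posbase chi s <-> hseq_posbase X s)).
Proof.
split=> [X /chirotope_hseq H|E0 chi /(chirotope_onT r_ge1) H].
  exists (chi_of (hseq_posbase X)).
  by split; [exact: chirotope_of_onT|exact: realizes_chi_of].
have T0 : [set: E] != set0 by rewrite -card_gt0 cardsT.
have [X hX Xs] := rank_datum_represents r_ge1 T0 H.
by exists X; split=> // s; apply: iff_sym; exact: Xs.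
Qed.
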